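(* Let $p \in L^2(0,T_{\mathrm{end}};Q)$ with $\partial_t p \in L^2(0,T_{\mathrm{end}};Q')$ be the solution of the abstract parabolic problem $$\langle \partial_t p(t), q\rangle + b(p(t),q) = (f,q)\quad\text{for all } q\in Q,\qquad p(0)=p_0.$$ Let $\tilde p \in L^2(0,T_{\mathrm{end}};\widetilde Q)$ with $\partial_t\tilde p\in L^2(0,T_{\mathrm{end}};\widetilde Q)$ be an arbitrary discrete approximation of $p$ (not necessarily satisfying the Galerkin equation $(\partial_t\tilde p(t),\tilde q)+b(\tilde p(t),\tilde q)=(f,\tilde q)$ for all $\tilde q\in\widetilde Q$). Let $\mathcal R_T[\tilde p](t)\in\widetilde Q$ denote the $\widetilde Q$-Riesz representative with respect to the $H$-inner product of the time-stepping residual of $\tilde p(t)$, i.e. $$(\mathcal R_T[\tilde p](t),\tilde q)=(\partial_t\tilde p(t),\tilde q)+b(\tilde p(t),\tilde q)-(f,\tilde q)\quad\text{for all }\tilde q\in\widetilde Q.$$ Let $\tilde p(t)=\tilde p^c(t)+\tilde p^d(t)$ be a decomposition with $\tilde p^c(t)\in Q$, $\tilde p^d(t)\in\widetilde Q$ for each $t$ (not necessarily unique), with $\tilde p^d,\partial_t\tilde p^d\in L^2(0,T_{\mathrm{end}};\widetilde Q)$. Put $e(t):=p(t)-\tilde p(t)$, $e^c(t):=p(t)-\tilde p^c(t)$ and $\varepsilon(t):=\mathcal E(\tilde p(t))-\tilde p(t)$, where $\mathcal E$ is the elliptic reconstruction. Then, with $C:=(3|||b|||^2+2)^{1/2}$,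 where $|||b|||$ denotes the continuity constant of $b$ on $Q$ with respect to $|||\cdot|||$, and with $C_{H,Q}^b$ a constant such that $\|q\|\le C_{H,Q}^b\,|||q|||$ for all $q\in Q$, $$\begin{aligned}\|e\|_{L^2(0,T_{\mathrm{end}};|||\cdot|||)}\le{}& \|e^c(0)\|+2\,\|\partial_t\tilde p^d\|_{L^2(0,T_{\mathrm{end}};|||\cdot|||_{Q,-1})}+(C+1)\,\|\varepsilon\|_{L^2(0,T_{\mathrm{end}};|||\cdot|||)}\\&+C\,\|\tilde p^d\|_{L^2(0,T_{\mathrm{end}};|||\cdot|||)}+2\,C_{H,Q}^b\,\|\mathcal R_T[\tilde p]\|_{L^2(0,T_{\mathrm{end}};H)}.\end{aligned}$$
   Context: Setting. $Q$ is a real Hilbert space densely (and continuously) embedded in another real Hilbert space $H$ (possibly $Q=H$), and $\widetilde Q\subseteq H$ is a finite dimensional subspace, not necessarily contained in $Q$. $(\cdot,\cdot)$ and $\|\cdot\|$ denote the $H$-inner product and the induced norm. $T_{\mathrm{end}}>0$, $f\in H$, $p_0\in Q$. The duality pairing $\langle\cdot,\cdot\rangle$ between $Q'$ and $Q$ is induced by the $H$-inner product via the Gelfand triple $Q\subseteq H=H'\subseteq Q'$. $b:(Q+\widetilde Q)\times(Q+\widetilde Q)\to\mathbb R$ is a bilinear form (not necessarily symmetric) which is continuous and coercive on $Q$. $|||\cdot|||$ is a norm on $Q+\widetilde Q$ which coincides on $Q$ with the square root of the symmetric part of $b$, i.e. $|||q|||^2=b(q,q)$ for $q\in Q$. The continuity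 constant $|||b|||$ of $b$ on $Q$ is the smallest constant with $|b(q,q')|\le|||b|||\,|||q|||\,|||q'|||$ for all $q,q'\in Q$. $|||\cdot|||_{Q,-1}$ is the dual norm on $Q$: for $g\in H$, $|||g|||_{Q,-1}:=\sup_{0\ne q\in Q}(g,q)/|||q|||$. For a norm $N$, $\|v\|_{L^2(0,T_{\mathrm{end}};N)}:=\big(\int_0^{T_{\mathrm{end}}}N(v(t))^2\,dt\big)^{1/2}$; $L^2(0,T_{\mathrm{end}};H)$ uses $N=\|\cdot\|$. Time derivatives are weak derivatives, and the time-dependent variational equations hold for almost every $t\in(0,T_{\mathrm{end}})$. Elliptic reconstruction. Let $\widetilde\Pi$ be the $H$-orthogonal projection onto $\widetilde Q$. For $\tilde q\in\widetilde Q$ let $B(\tilde q)\in\widetilde Q$ be the $H$-Riesz representative of $b(\tilde q,\cdot)$ on $\widetilde Q$, i.e. $(B(\tilde q),\tilde q')=b(\tilde q,\tilde q')$ for all $\tilde q'\in\widetilde Q$. The elliptic reconstruction $\mathcal E(\tilde q)\in Q$ is the unique solution of $b(\mathcal E(\tilde q),q')=(B(\tilde q)-\widetilde\Pi(f)+f,\,q')$ for all $q'\in Q$. *)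

(* Defs.v *)
From HB Require Import structures.
From mathcomp Require Export all_boot all_order all_algebra.
From mathcomp Require Export all_classical all_reals all_analysis.
Export Order.TTheory GRing.Theory Num.Theory.
Export numFieldNormedType.Exports.

Set Implicit Arguments.
Unset Strict Implicit.
Unset Printing Implicit Defensive.

Local Open Scope classical_set_scope.
Local Open Scope ring_scope.

(* A real Hilbert space is a [completeNormedModType R] together with an inner
   product inducing its norm. *)
Definition inner_product (R : realType) (H : normedModType R)
    (ip : H -> H -> R) : Prop :=
  [/\ forall (a : R) (x y z : H), ip (a *: x + y) z = a * ip x z + ip y z,
      forall x y : H, ip x y = ip y x
    & forall x : H, ip x x = `|x| ^+ 2].

Definition finite_dim_subspace (R : realType) (H : lmodType R)
    (S : set H) : Prop :=
  exists (n : nat) (v : 'I_n -> H),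
    S = [set \sum_(i < n) c i *: v i | c in [set: 'I_n -> R]].

(* The sum Q + Qt, formed inside H. *)
Definition sum_space (R : realType) (Q H : lmodType R) (iota : Q -> H)
    (Qt : set H) : set H :=
  [set x | exists q w, Qt w /\ x = iota q + w].

(* Bilinear forms and norms on a subspace V of H are represented by functions
   on H, whose values outside V are irrelevant. *)
Definition bilinear_on (R : realType) (H : lmodType R) (V : set H)
    (b : H -> H -> R) : Prop :=
  forall (a : R) (x y z : H), V x -> V y -> V z ->
    b (a *: x + y) z = a * b x z + b y z /\
    b z (a *: x + y) = a * b z x + b z y.

Definition norm_on (R : realType) (H : lmodType R) (V : set H)
    (N : H -> R) : Prop :=
  [/\ forall x, V x -> 0 <= N x,
      forall x, V x -> N x = 0 -> x = 0,
      forall (a : R) x, V x -> N (a *: x) = `|a| * N x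
    & forall x y, V x -> V y -> N (x + y) <= N x + N y].

Definition bounded_form (R : realType) (Q : normedModType R)
    (b : Q -> Q -> R) : Prop :=
  exists M : R, forall q q' : Q, `|b q q'| <= M * `|q| * `|q'|.

Definition coercive_form (R : realType) (Q : normedModType R)
    (b : Q -> Q -> R) : Prop :=
  exists2 alpha : R, 0 < alpha & forall q : Q, alpha * `|q| ^+ 2 <= b q q.

(* The constraint [0 <= c] only matters when Q = {0}. *)
Definition continuity_constant (R : realType) (Q : Type)
    (N : Q -> R) (b : Q -> Q -> R) : R :=
  inf [set c : R | 0 <= c /\ forall q q', `|b q q'| <= c * N q * N q'].

Definition dual_norm (R : realType) (Q H : lmodType R) (ip : H -> H -> R)
    (iota : Q -> H) (N : H -> R) (g : H) : R :=
  sup [set ip g (iota q) / N (iota q) | q in [set q : Q | q != 0]].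

(* The topological dual Q' as a set of functions, and its operator norm. *)
Definition top_dual (R : realType) (Q : normedModType R) : set (Q -> R) :=
  [set g | (forall (a : R) (x y : Q), g (a *: x + y) = a * g x + g y) /\
           continuous g].

Definition top_dual_norm (R : realType) (Q : normedModType R)
    (g : Q -> R) : R :=
  sup [set `|g q| | q in [set q : Q | `|q| <= 1]].

Definition riesz_representative (R : realType) (H : Type)
    (ip : H -> H -> R) (S : set H) (l : H -> R) (w : H) : Prop :=
  S w /\ forall w', S w' -> ip w w' = l w'.

Definition orthogonal_projection (R : realType) (H : lmodType R)
    (ip : H -> H -> R) (S : set H) (P : H -> H) : Prop :=
  forall x, S (P x) /\ forall w, S w -> ip (x - P x) w = 0.

Definition ae_in (R : realType) (T : R) (P : R -> Prop) : Prop :=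
  {ae (@lebesgue_measure R), forall t : R, 0 < t < T -> P t}.

Definition simple_fun (R : realType) (X : Type) (S : set X)
    (s : R -> X) : Prop :=
  [/\ finite_set (range s), forall t, S (s t)
    & forall x, measurable (s @^-1` [set x] : set (measurableTypeR R))].

(* Strong (Bochner) measurability on (0, T) of a function with values in the
   normed space (S, N). *)
Definition strongly_measurable (R : realType) (X : zmodType) (S : set X)
    (N : X -> R) (T : R) (v : R -> X) : Prop :=
  exists s : nat -> R -> X, (forall n, simple_fun S (s n)) /\
    ae_in T (fun t => N (s n t - v t) @[n --> \oo] --> (0 : R)).

Definition L2norm (R : realType) (X : Type) (T : R) (N : X -> R)
    (v : R -> X) : \bar R :=
  sqrte (\int[@lebesgue_measure R]_(t in `]0%R, T[) ((N (v t)) ^+ 2)%:E)%E.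

(* The Bochner space L^2(0, T; (S, N)). *)
Definition L2 (R : realType) (X : zmodType) (S : set X) (N : X -> R) (T : R)
    (v : R -> X) : Prop :=
  [/\ ae_in T (fun t => S (v t)), strongly_measurable S N T v
    & (L2norm T N v < +oo)%E].

Definition test_function (R : realType) (T : R) (phi : R -> R) : Prop :=
  (forall (n : nat) (t : R), derivable (derive1n n phi) t 1) /\
  exists a c : R, [/\ 0 < a, c < T
    & forall t, ~ (a <= t <= c) -> phi t = 0].

Definition weak_derivative (R : realType) (T : R) (u du : R -> R) : Prop :=
  forall phi : R -> R, test_function T phi ->
    \int[@lebesgue_measure R]_(t in `]0, T[) (u t * derive1 phi t) =
    - \int[@lebesgue_measure R]_(t in `]0, T[) (du t * phi t).

(* Weak derivatives of functions with values in H or Q.  The defining identity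
   int u phi' = - int u' phi between vectors is evaluated against every
   element; for u with values in Q and u' with values in Q', the pairing of
   u(t) with q is the one of the Gelfand triple, i.e. the H-inner product. *)
Definition weak_derivative_H (R : realType) (H : Type) (ip : H -> H -> R)
    (T : R) (u du : R -> H) : Prop :=
  forall w : H, weak_derivative T (fun t => ip (u t) w) (fun t => ip (du t) w).

Definition weak_derivative_Gelfand (R : realType) (Q H : Type)
    (ip : H -> H -> R) (iota : Q -> H) (T : R) (u : R -> Q)
    (du : R -> Q -> R) : Prop :=
  forall q : Q,
    weak_derivative T (fun t => ip (iota (u t)) (iota q)) (fun t => du t q).

(* Functions in L^2 being defined up to null sets, u(0) is the value at 0 of
   the representative of u in C([0, T]; H). *)
Definition initial_value (R : realType) (H : normedModType R) (T : R)
    (u : R -> H) (a : H) : Prop :=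
  exists w : R -> H, [/\ {within `[0, T], continuous w},
    ae_in T (fun t => u t = w t) & w 0 = a].

Definition at0 (R : realType) (H : normedModType R) (T : R) (u : R -> H) : H :=
  get (initial_value T u).

(* Main.v *)
(** Subtracting the weak equations gives, for every [q] in [Q],
    [<dt e^c, q> = (f, q) - b(p, q) - (dt pt, q) + (dt ptd, q)], and by the
    definition of the elliptic reconstruction the right-hand side at [q = e^c] is
    at most [- |||e^c|||^2 + kappa |||e^c|||] with
    [kappa = |||b||| (|||eps||| + |||ptd|||) + |||dt ptd|||_{Q,-1} + C_{H,Q} ||R_T||].
    The energy inequality [- int <dt e^c, e^c> <= ||e^c(0)||^2 / 2] and Young's
    inequality bound the [L^2] norm of [|||e^c|||] by [||e^c(0)||] plus that of
    [kappa]; the claim follows since [|||e||| <= |||e^c||| + |||ptd|||] and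
    [|||b||| + 1 <= C].

    Only this inequality is needed, not the chain rule for [||e^c||^2]. With [U]
    the continuous representative of [e^c], the backward quotients satisfy
    [2 (U t - U (t - h), U t) >= ||U t||^2 - ||U (t - h)||^2], whose mean over
    [(0, T)] is bounded below by [- ||U 0||^2]. They converge to
    [2 <dt e^c, e^c>] almost everywhere and, up to an integrable correction, have
    a sign, so Fatou's lemma applies. Scalar weak derivatives are turned into
    primitives by testing with smooth steps placed at Lebesgue points. *)
Require Import Defs.
From mathcomp Require Import measurable_realfun ring lra.

Set Implicit Arguments.
Unset Strict Implicit.
Unset Printing Implicit Defensive.

Local Open Scope classical_set_scope.
Local Open Scope ring_scope.

(** Two obstacles shape the proof. The derivative of [e^c] is known only through its pairings with
    fixed vectors [z] of [Q], each off a null set that depends on [z], whereas the energy argument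
    pairs it with the moving vector [e^c(t)]. No vector-valued integral is formed: [e^c(t)] is
    approximated by simple functions, which take countably many values altogether, and the remainder
    is controlled by a square integrable bound [gam] on the derivative as a functional on [Q]. The
    same [gam] yields the integrable correction [gam^2 / 2 + |e^c|^2 / 2]; it appears on both sides
    of the final inequality and cancels, so it leaves no trace in the constants.

    The other obstacle is measurability. The norm, the Riesz map and the reconstruction are bare
    functions on [H], specified on a subspace only. Vectors of [Qt] are therefore expanded in
    finitely many coefficients that are linear in the vector; along such an expansion the norm is
    Lipschitz for the norm of [H], and the reconstruction is affine. Quantities that escape this
    treatment are compared through lower integrals. *)

(** * Integrals of functions that may fail to be measurable *)

Section lower_integral.
Context d (X : measurableType d) (R : realType) (mu : {measure set X -> \bar R}).
Import HBNNSimple.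
Local Open Scope ereal_scope.

(* The integral of a nonnegative function, measurable or not, is the supremum
   of the integrals of the simple functions below it. *)
Lemma ge0_ae_le_lower_integral (D : set X) (f g : X -> \bar R) :
  (forall x, D x -> 0 <= f x) -> (forall x, D x -> 0 <= g x) ->
  {ae mu, forall x, D x -> f x <= g x} ->
  \int[mu]_(x in D) f x <= \int[mu]_(x in D) g x.
Proof.
move=> f0 g0 [Z [mZ muZ fgZ]].
rewrite !ge0_integralE//; apply: ge_ereal_sup => _ [h/= hf] <-.
apply: le_ereal_sup_tmp.
(* The simple function [h] below [f] is cut off to zero on the null set [Z]: it then lies below [g]
   everywhere and keeps its integral. *)
exists (sintegral mu (proj_nnsfun h (measurableC mZ))).
- exists (proj_nnsfun h (measurableC mZ)) => // x.
  rewrite -mrestrict {1}/patch in_setC.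
  have [xZ|/negP xZ] := boolP (x \in Z).
    by rewrite /patch; case: ifPn => // /set_mem /g0.
  rewrite /= (le_trans (hf x))// /patch; case: ifPn => // /set_mem Dx.
  apply: contrapT => nfg; apply: xZ; apply/mem_set; apply: fgZ => /=.
  by move/(_ Dx).
- rewrite -!integralT_nnsfun le_eqVlt; apply/orP; left; apply/eqP.
  apply: ge0_ae_eq_integral => //.
  + exact/measurable_EFinP.
  + exact/measurable_EFinP.
  + by move=> x _; rewrite lee_fin.
  + by move=> x _; rewrite lee_fin.
  + exists Z; split => // x /= /not_implyP[_].
    have /= <- := congr1 (@^~ x) (mrestrict h (measurableC mZ)).
    rewrite /patch in_setC => nh.
    by apply: contrapT => nZ; apply: nh; rewrite memNset.
Qed.

Lemma ge0_ae_eq_lower_integral (D : set X) (f g : X -> \bar R) :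
  (forall x, D x -> 0 <= f x) -> (forall x, D x -> 0 <= g x) ->
  {ae mu, forall x, D x -> f x = g x} ->
  \int[mu]_(x in D) f x = \int[mu]_(x in D) g x.
Proof.
move=> f0 g0 fg; apply/eqP; rewrite eq_le; apply/andP.
by split; apply: ge0_ae_le_lower_integral => //;
  apply: filterS fg => x fg /fg ->.
Qed.

(** Positive and negative parts are compared separately as lower integrals. This lets
    representatives be exchanged inside [weak_derivative]. *)
Lemma ae_eq_Rintegral (D : set X) (f g : X -> R) :
  {ae mu, forall x, D x -> f x = g x} ->
  (\int[mu]_(x in D) f x = \int[mu]_(x in D) g x)%R.
Proof.
move=> fg; rewrite /Rintegral integralE [in RHS]integralE; congr (fine (_ - _)).
- by apply: ge0_ae_eq_lower_integral => //; apply: filterS fg => x fg /fg;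
    rewrite !funeposE /= => ->.
- by apply: ge0_ae_eq_lower_integral => //; apply: filterS fg => x fg /fg;
    rewrite !funenegE /= => ->.
Qed.

End lower_integral.

(** * A smooth transition function *)

Section smooth_functions.
Context {R : realType}.
Implicit Types (f g : R -> R) (k n : nat) (x t : R).

(** Peeling the derivative off the function itself, rather than iterating from outside, gives
    closure under products, inverses and affine substitutions by induction on [k]. *)
Fixpoint differentiable_times k f : Prop :=
  if k is k'.+1 then (forall t, derivable f t 1) /\ differentiable_times k' (derive1 f)
  else True.

Lemma differentiable_timesS k f f' : (forall t, is_derive t 1 f (f' t)) ->
  differentiable_times k f' -> differentiable_times k.+1 f.
Proof.
move=> df ck /=; split=> [t|]; first by have [] := df t.
suff -> : derive1 f = f' by [].
by apply/funext => t; rewrite derive1E; have [] := df t.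
Qed.

Lemma differentiable_timesP k f : differentiable_times k.+1 f ->
  (forall t, is_derive t 1 f (derive1 f t)) /\ differentiable_times k (derive1 f).
Proof.
by move=> [df ck]; split=> // t; rewrite derive1E; exact: derivableP.
Qed.

Lemma differentiable_timesW k f :
  differentiable_times k.+1 f -> differentiable_times k f.
Proof. by elim: k f => // k IH f [df /IH]. Qed.

Lemma differentiable_times_derive1n f : (forall k, differentiable_times k f) ->
  forall n t, derivable (derive1n n f) t 1.
Proof.
move=> cf n; move: (cf n.+1); elim: n f {cf} => [f [] //|n IH f [_ cf] t].
by rewrite derive1Sn; exact: IH.
Qed.

Lemma differentiable_times_cst k (c : R) : differentiable_times k (fun=> c).
Proof.
elim: k c => // k IH c; apply: (@differentiable_timesS _ _ (fun=> 0)) => // t.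
Qed.

Lemma differentiable_timesD k f g : differentiable_times k f ->
  differentiable_times k g -> differentiable_times k (fun x => f x + g x).
Proof.
elim: k f g => // k IH f g /differentiable_timesP[df cf].
move=> /differentiable_timesP[dg cg].
apply: differentiable_timesS; last exact: IH cf cg.
Qed.

Lemma differentiable_timesM k f g : differentiable_times k f ->
  differentiable_times k g -> differentiable_times k (fun x => f x * g x).
Proof.
elim: k f g => // k IH f g cf cg.
have [df cf'] := differentiable_timesP cf.
have [dg cg'] := differentiable_timesP cg.
apply: (@differentiable_timesS _ _ (fun x => f x * derive1 g x + g x * derive1 f x)).
by apply: differentiable_timesD; apply: IH => //; exact: differentiable_timesW.
Qed.

Lemma differentiable_timesV k f : (forall x, f x != 0) ->
  differentiable_times k f -> differentiable_times k (fun x => (f x)^-1).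
Proof.
move=> f0; elim: k => // k IH cf.
have [df cf'] := differentiable_timesP cf.
apply: (@differentiable_timesS _ _
    (fun x => (-1 * ((f x)^-1 * (f x)^-1)) * derive1 f x)).
  move=> t; have := @is_deriveV R f t (derive1 f t) 1 (f0 t) (df t).
  by rewrite -[_ *: _]/(_ * _) mulN1r -expr2 exprVn.
have cV := IH (differentiable_timesW cf).
apply: differentiable_timesM => //; apply: differentiable_timesM.
  exact: differentiable_times_cst.
exact: differentiable_timesM.
Qed.

Lemma differentiable_times_affine k f (a c : R) : differentiable_times k f ->
  differentiable_times k (fun x => f (a * x + c)).
Proof.
elim: k f => // k IH f cf; have [df cf'] := differentiable_timesP cf.
apply: (@differentiable_timesS _ _ (fun x => derive1 f (a * x + c) * a)).
  move=> t; apply: (@is_derive1_comp R f (fun x => a * x + c)) => //.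
  rewrite [X in is_derive _ _ _ X](_ : a = a *: 1 + 0); last first.
    by rewrite addr0 -[_ *: _]/(_ * _) mulr1.
  apply: is_deriveD; exact: (@is_deriveZ _ _ _ id).
apply: differentiable_timesM; first exact: IH.
exact: differentiable_times_cst.
Qed.

(** Serves the point 0, where [flat] changes its formula: a quadratic remainder replaces a
    computation of the difference quotient. *)
Lemma is_derive_quadratic f x (a C : R) :
  (forall h, `|f (x + h) - f x - a * h| <= C * h ^+ 2) -> is_derive x 1 f a.
Proof.
move=> fC.
have lim : (h^-1 *: (f (h *: 1 + x) - f x) @[h --> 0^']) --> a.
  apply/cvgrPdist_le => /= e e0; near=> h.
  have h0 : h != 0 by near: h; exact: nbhs_dnbhs_neq.
  rewrite -[_ *: (_ : R)]/(_ * _) -[h *: 1]/(h * 1) mulr1.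
  have h0' : 0 < `|h| by rewrite normr_gt0.
  rewrite -(ler_pM2l h0') -normrM.
  have -> : h * (a - h^-1 * (f (h + x) - f x)) = - (f (x + h) - f x - a * h).
    by rewrite [h + x]addrC; field.
  rewrite normrN (le_trans (fC h))// -real_normK ?num_real// expr2.
  rewrite mulrA [C * _]mulrC -mulrA ler_wpM2l//.
  have C1 : 0 < `|C| + 1 by rewrite ltr_wpDl.
  apply: (@le_trans _ _ ((`|C| + 1) * `|h|)).
    by rewrite ler_wpM2r// (le_trans (ler_norm C))// lerDl.
  rewrite mulrC -ler_pdivlMr//.
  near: h; apply: dnbhs0_le; exact: divr_gt0.
by split; [apply/cvg_ex; exists a|apply/cvg_lim].
Unshelve. all: by end_near. Qed.

(** The classical flat function [exp (-1/x)], with a weight [x^-n] so that the derivatives stay in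
    the span of the family; smoothness of every order is then a single induction. *)
Definition flat n x : R := if 0 < x then x^-1 ^+ n * expR (- x^-1) else 0.

(** With [y = 1/x], one term of the exponential series gives [exp y >= y^(n+2) / (n+2)!], which
    absorbs [y^n] and leaves [x^2]. *)
Lemma flat_le n x : `|flat n x| <= (n.+2)`!%:R * x ^+ 2.
Proof.
rewrite /flat; case: ifPn => [x0|_]; last first.
  by rewrite normr0 mulr_ge0// sqr_ge0.
have y0 : 0 < x^-1 by rewrite invr_gt0.
rewrite ger0_norm ?mulr_ge0 ?expR_ge0 ?exprn_ge0 ?(ltW y0)//.
rewrite expRN -ler_pdivrMr ?exprn_gt0//.
have -> : x^-1 ^+ n / expR x^-1 / x ^+ 2 = x^-1 ^+ n.+2 / expR x^-1.
  by rewrite mulrAC -exprVn -exprD addn2.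
rewrite ler_pdivrMr ?expR_gt0// mulrC -ler_pdivrMr ?ltr0n ?fact_gt0//.
by apply: le_trans (expR_ge1Dxn n.+1 (ltW y0)); rewrite lerDr.
Qed.

Lemma is_derive_flat n x :
  is_derive x 1 (flat n) (flat n.+2 x - n%:R * flat n.+1 x).
Proof.
have [x0|x0|<-] := ltgtP 0 x.
- apply: (@near_eq_is_derive _ _ _
      ((fun y => y^-1) ^+ n * (expR \o (fun y : R => - y^-1)))).
    near=> y; have y0 : 0 < y by near: y; exact: lt_nbhsr.
    by rewrite /flat y0 !fctE.
  have dV : is_derive x 1 (fun y : R => y^-1) (- x ^- 2).
    have := @is_deriveV R id x 1 1 (lt0r_neq0 x0) (is_derive_id _ _).
    by rewrite -[_ *: _]/(_ * _) mulr1.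
  have dE := @is_derive1_comp R expR (fun y => - y^-1) x _ _ (is_derive_expR _)
    (is_deriveN dV).
  have := is_deriveM (is_deriveX n dV) dE.
  have fE m : flat m x = x^-1 ^+ m * expR (- x^-1) by rewrite /flat x0.
  rewrite !fE; congr is_derive; rewrite -![_ *: _]/(_ * _) !fctE/= opprK.
  by case: n {fE} => [|n] /=; rewrite !exprS; field; rewrite lt0r_neq0.
- apply: (@near_eq_is_derive _ _ _ (fun=> 0)).
    near=> y; have y0 : y < 0 by near: y; exact: lt_nbhsl.
    by rewrite /flat ltNge (ltW y0).
  by rewrite /flat ltNge (ltW x0)/= mulr0 subr0; exact: is_derive_cst.
- apply: (@is_derive_quadratic _ _ _ (n.+2)`!%:R) => h.
  by rewrite {2 3 4}/flat ltxx mulr0 !subr0 mul0r subr0 add0r; exact: flat_le.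
Unshelve. all: by end_near. Qed.

Lemma differentiable_times_flat k n : differentiable_times k (flat n).
Proof.
elim: k n => // k IH n; apply: differentiable_timesS (is_derive_flat n) _.
apply: differentiable_timesD => //.
have -> : (fun x => - (n%:R * flat n.+1 x)) = (fun x => - n%:R * flat n.+1 x).
  by apply/funext => x; rewrite mulNr.
by apply: differentiable_timesM => //; exact: differentiable_times_cst.
Qed.

(** The denominator is positive because [x] and [1 - x] are never both nonpositive. *)
Definition smooth_step x : R := flat 0 x / (flat 0 x + flat 0 (1 - x)).

Lemma flat_ge0 n x : 0 <= flat n x.
Proof.
rewrite /flat; case: ifPn => // x0.
by rewrite mulr_ge0 ?expR_ge0// exprn_ge0// invr_ge0 ltW.
Qed.

Lemma flat_gt0 n x : 0 < x -> 0 < flat n x.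
Proof. by move=> x0; rewrite /flat x0 mulr_gt0 ?expR_gt0// exprn_gt0// invr_gt0. Qed.

Lemma flat_eq0 n x : x <= 0 -> flat n x = 0.
Proof. by move=> x0; rewrite /flat ltNge x0. Qed.

Lemma smooth_step_den x : 0 < flat 0 x + flat 0 (1 - x).
Proof.
have [x0|x0] := ltP 0 x; first by rewrite ltr_pwDl ?flat_gt0 ?flat_ge0.
by rewrite ltr_wpDl ?flat_ge0// flat_gt0//; lra.
Qed.

Lemma smooth_step_eq0 x : x <= 0 -> smooth_step x = 0.
Proof. by move=> x0; rewrite /smooth_step flat_eq0// mul0r. Qed.

Lemma smooth_step_eq1 x : 1 <= x -> smooth_step x = 1.
Proof.
move=> x1; rewrite /smooth_step [X in _ + X]flat_eq0 ?subr_le0// addr0 divff//.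
by rewrite lt0r_neq0// flat_gt0//; lra.
Qed.

Lemma smooth_step_ge0 x : 0 <= smooth_step x.
Proof. by rewrite /smooth_step divr_ge0 ?flat_ge0// ltW// smooth_step_den. Qed.

Lemma smooth_step_le1 x : smooth_step x <= 1.
Proof.
by rewrite /smooth_step ler_pdivrMr ?smooth_step_den// mul1r lerDl flat_ge0.
Qed.

Lemma differentiable_times_smooth_step k : differentiable_times k smooth_step.
Proof.
apply: differentiable_timesM; first exact: differentiable_times_flat.
apply: (@differentiable_timesV _ (fun x => flat 0 x + flat 0 (1 - x))) => [x|].
  by rewrite lt0r_neq0// smooth_step_den.
apply: differentiable_timesD; first exact: differentiable_times_flat.
have -> : (fun x => flat 0 (1 - x)) = (fun x => flat 0 (-1 * x + 1)).
  by apply/funext => x; rewrite mulN1r addrC.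
by apply: differentiable_times_affine; exact: differentiable_times_flat.
Qed.

Lemma is_derive_smooth_step x :
  is_derive x 1 smooth_step (derive1 smooth_step x).
Proof. by have [] := differentiable_timesP (differentiable_times_smooth_step 1). Qed.

Lemma continuous_smooth_step' : continuous (derive1 smooth_step : R -> R).
Proof.
move=> x; apply: differentiable_continuous; apply/derivable1_diffP.
by have [_ []] := differentiable_times_smooth_step 2.
Qed.

Lemma smooth_step'_eq0 x : ~~ (0 <= x <= 1) -> derive1 smooth_step x = 0.
Proof.
rewrite negb_and -!ltNge => /orP[x0|x1]; rewrite derive1E.
- rewrite (@near_eq_derive _ R R _ (fun=> 0 : R)); first exact: derive_cst.
  near=> y; rewrite smooth_step_eq0// ltW//; near: y; exact: lt_nbhsl.
- rewrite (@near_eq_derive _ R R _ (fun=> 1 : R)); first exact: derive_cst.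
  near=> y; rewrite smooth_step_eq1// ltW//; near: y; exact: lt_nbhsr.
Unshelve. all: by end_near. Qed.

Lemma bounded_smooth_step' : exists M : R, forall x, `|derive1 smooth_step x| <= M.
Proof.
have c01 : {within `[(0:R), 1], continuous (fun x => `|derive1 smooth_step x|)}.
  apply: continuous_subspaceT => x.
  apply: continuous_comp; [exact: continuous_smooth_step'|exact: norm_continuous].
have [c _ cM] := EVT_max ler01 c01.
exists (`|derive1 smooth_step c|) => x.
have [x01|x01] := boolP (0 <= x <= 1); first by apply: cM; rewrite in_itv.
by rewrite smooth_step'_eq0// normr0.
Qed.

End smooth_functions.

(** * One-sided approximate identities *)

Section approximate_identity.
Context {R : realType}.
Local Notation mu := (@lebesgue_measure R).
Implicit Types (s t r x : R).

(** Rises from 0 to 1 on [[s, s + r]]; the argument is in the affine form that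
    [differentiable_times_affine] expects. *)
Definition step s r x : R := smooth_step (r^-1 * x + - (s / r)).

(** The derivative of [step s r]: mass one, height of order [1/r], support to the right of [s]. *)
Definition kern s r x : R := derive1 smooth_step (r^-1 * x + - (s / r)) * r^-1.

Lemma step_argE s r x : r^-1 * x + - (s / r) = (x - s) / r.
Proof. by rewrite mulrBl mulrC. Qed.

Lemma step_eq0 s r x : 0 < r -> x <= s -> step s r x = 0.
Proof.
move=> r0 xs; rewrite /step step_argE smooth_step_eq0// ler_pdivrMr// mul0r.
by rewrite subr_le0.
Qed.

Lemma step_eq1 s r x : 0 < r -> s + r <= x -> step s r x = 1.
Proof.
move=> r0 xs; rewrite /step step_argE smooth_step_eq1// ler_pdivlMr// mul1r.
by rewrite lerBrDl.
Qed.

Lemma is_derive_step s r x : is_derive x 1 (step s r) (kern s r x).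
Proof.
apply: (@is_derive1_comp R smooth_step (fun x => r^-1 * x + - (s / r))).
  exact: is_derive_smooth_step.
rewrite [X in is_derive _ _ _ X](_ : r^-1 = r^-1 *: 1 + 0); last first.
  by rewrite addr0 -[_ *: _]/(_ * _) mulr1.
by apply: is_deriveD; exact: (@is_deriveZ _ _ _ id).
Qed.

Lemma differentiable_times_step k s r : differentiable_times k (step s r).
Proof.
exact: (differentiable_times_affine _ _ (differentiable_times_smooth_step k)).
Qed.

Lemma continuous_step s r : continuous (step s r).
Proof.
move=> x; apply: differentiable_continuous; apply/derivable1_diffP.
by have [] := is_derive_step s r x.
Qed.

Lemma continuous_affine_scale (f : R -> R) (a c d : R) : continuous f ->
  continuous (fun x => f (a * x + c) * d).
Proof.
move=> cf x; apply: cvgM; last exact: cvg_cst.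
apply: (@continuous_comp _ _ _ (fun x : R => a * x + c) f); last exact: cf.
apply: cvgD; last exact: cvg_cst.
by apply: cvgM; [exact: cvg_cst|exact: cvg_id].
Qed.

Lemma continuous_kern s r : continuous (kern s r).
Proof. exact/continuous_affine_scale/continuous_smooth_step'. Qed.

Lemma kern_eq0 s r x : 0 < r -> ~ (s <= x <= s + r) -> kern s r x = 0.
Proof.
move=> r0 xsr; rewrite /kern step_argE smooth_step'_eq0 ?mul0r//.
apply/negP => /andP[x0 x1]; apply: xsr; apply/andP; split.
  by move: x0; rewrite ler_pdivlMr// mul0r subr_ge0.
by move: x1; rewrite ler_pdivrMr// mul1r lerBlDl.
Qed.

Lemma kern_bounded :
  exists2 M : R, 0 <= M & forall s r x, 0 < r -> `|kern s r x| <= M / r.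
Proof.
have [M hM] := @bounded_smooth_step' R; exists M.
  exact: le_trans (normr_ge0 _) (hM 0).
move=> s r x r0; rewrite normrM (@ger0_norm _ r^-1) ?invr_ge0 ?(ltW r0)//.
by rewrite ler_wpM2r// invr_ge0 ltW.
Qed.

Lemma integral_kern s r : 0 < r ->
  \int[mu]_(x in `[s, (s + r)]) kern s r x = 1.
Proof.
move=> r0; rewrite /Rintegral (@continuous_FTC2 _ _ (step s r)).
- by rewrite step_eq1// step_eq0//= subr0.
- by rewrite ltrDl.
- exact/continuous_subspaceT/continuous_kern.
- split.
  + by move=> x _; exact: (@ex_derive _ _ _ _ _ _ _ (is_derive_step s r x)).
  + exact/cvg_at_right_filter/continuous_step.
  + exact/cvg_at_left_filter/continuous_step.
- by move=> x _; rewrite derive1E; exact: (@derive_val _ _ _ _ _ _ _ (is_derive_step s r x)).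
Qed.

Lemma measurable_kern s r : measurable_fun setT (kern s r).
Proof. by apply: continuous_measurable_fun; exact: continuous_kern. Qed.

Lemma measurable_step s r : measurable_fun setT (step s r).
Proof. by apply: continuous_measurable_fun; exact: continuous_step. Qed.

Lemma integrableM_bounded (D : set (measurableTypeR R)) (u h : R -> R) (M : R) :
  measurable D -> mu.-integrable D (EFin \o u) -> measurable_fun setT h ->
  (forall x, `|h x| <= M) ->
  mu.-integrable D (EFin \o (fun x => u x * h x)).
Proof.
move=> mD iu mh hM.
apply: (@integrableMl _ _ _ mu D _ (EFin \o u) h) => //.
  exact: measurable_funS mh.
exists M; split; first exact: num_real.
by move=> y My x _; exact: le_trans (hM x) (ltW My).
Qed.

(** As [kern] has mass one, the difference is the integral of [u x - u s] against it. With [kern] at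
    most [M / r] and a ball of measure [4 r], the factor is [4 M]. The radius is [r + r] so that the
    open ball contains the end point [s + r]. *)
Lemma kern_davg : exists2 M : R, 0 <= M & forall (u : R -> R) s r, 0 < r ->
  mu.-integrable setT (EFin \o u) ->
  (`|\int[mu]_x (u x * kern s r x) - u s|%:E <= M%:E * davg u s (r + r))%E.
Proof.
have [M M0 hM] := kern_bounded; exists (4 * M); first by rewrite mulr_ge0.
move=> u s r r0 iu; pose I : set (measurableTypeR R) := `[s, (s + r)]%classic.
have mI : measurable I by exact: measurable_itv.
have iuI : mu.-integrable I (EFin \o u) by exact: integrableS iu.
have ikI : mu.-integrable I (EFin \o kern s r).
  apply: continuous_compact_integrable; first exact: segment_compact.
  exact/continuous_subspaceT/continuous_kern.
have iukI : mu.-integrable I (EFin \o (fun x => u x * kern s r x)).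
  by apply: integrableM_bounded => //; [exact: measurable_kern|move=> x; exact: hM].
have icI : mu.-integrable I (EFin \o cst (u s)).
  apply: continuous_compact_integrable; first exact: segment_compact.
  by apply: continuous_subspaceT => x; exact: cst_continuous.
have iduI : mu.-integrable I (EFin \o (fun x => u x - u s)).
  by have := integrableB mI iuI icI; apply: eq_integrable.
have ickI : mu.-integrable I (EFin \o (fun x => u s * kern s r x)).
  by have := integrableZl mI (u s) ikI; apply: eq_integrable.
have idkI : mu.-integrable I (EFin \o (fun x => (u x - u s) * kern s r x)).
  by apply: integrableM_bounded => //; [exact: measurable_kern|move=> x; exact: hM].
have -> : \int[mu]_x (u x * kern s r x) - u s =
          \int[mu]_(x in I) ((u x - u s) * kern s r x).
  under [RHS]eq_Rintegral do rewrite mulrBl.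
  rewrite RintegralB// RintegralZl// integral_kern// mulr1; congr (_ - _).
  rewrite [RHS]Rintegral_mkcond; apply: eq_Rintegral => x _.
  rewrite /patch; case: ifPn => // /negP xI; rewrite kern_eq0 ?mulr0//.
  by move=> xsr; apply: xI; apply/mem_set; rewrite /I /= in_itv.
rewrite EFin_normr_Rintegral//.
apply: le_trans (le_abse_integral _ _ _) _ => //; first by case/integrableP: idkI.
apply: (@le_trans _ _ (\int[mu]_(x in I) ((M / r)%:E * `|(u x - u s)%:E|))%E).
  apply: ge0_le_integral => //.
  - by apply: measurableT_comp => //; case/integrableP: idkI.
  - apply: emeasurable_funM => //.
    by apply: measurableT_comp => //; case/integrableP: iduI.
  - by move=> x _; rewrite -EFinM lee_fin normrM mulrC ler_wpM2r// hM.
rewrite ge0_integralZl//; first last.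
- by rewrite lee_fin divr_ge0// ltW.
- by apply: measurableT_comp => //; case/integrableP: iduI.
rewrite /davg /iavg lebesgue_measure_ball; last by rewrite addr_ge0// ltW.
have -> : ((4 * M)%:E = (M / r)%:E * ((r + r) *+ 2)%:E)%E.
  by rewrite -EFinM; congr EFin; field; rewrite lt0r_neq0.
have r4 : 0 < (r + r) *+ 2 by rewrite pmulrn_lgt0// addr_gt0.
rewrite -muleA lee_wpmul2l ?lee_fin ?divr_ge0 ?(ltW r0)//.
rewrite inver gt_eqF// muleA -EFinM divff ?gt_eqF// mul1e.
apply: ge0_subset_integral => //.
- exact: measurable_ball.
- do 2 apply: measurableT_comp => //.
  apply: measurable_funD => //; apply: (@measurable_funS _ _ _ _ setT) => //.
  by apply/measurable_EFinP; case/integrableP: iu.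
- move=> x; rewrite /I /= in_itv/= => /andP[sx xs]; rewrite /ball/= distrC.
  by rewrite ger0_norm ?subr_ge0//; lra.
Qed.

End approximate_identity.

(** * Properties holding almost everywhere on [(0, T)] *)

Section ae_in.
Context {R : realType}.
Local Notation mu := (@lebesgue_measure R).
Implicit Types (T : R) (P Q : R -> Prop).

Lemma ae_inS T P Q : (forall t, 0 < t < T -> P t -> Q t) ->
  ae_in T P -> ae_in T Q.
Proof.
move=> PQ [Z [mZ muZ hZ]]; exists Z; split => // t /= nQ; apply: hZ => /= hP.
by apply: nQ => tT; exact: PQ (hP tT).
Qed.

Lemma ae_inI T P Q : ae_in T P -> ae_in T Q -> ae_in T (fun t => P t /\ Q t).
Proof.
move=> [Z [mZ muZ hZ]] [Z' [mZ' muZ' hZ']]; exists (Z `|` Z'); split.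
- exact: measurableU.
- by rewrite measureU0.
- move=> t /= nPQ; apply: contrapT => /not_orP[nZ nZ']; apply: nPQ => tT.
  by split; apply: contrapT => h; [apply: nZ; apply: hZ|apply: nZ'; apply: hZ'];
    move=> /= /(_ tT).
Qed.

Lemma ae_inW T P : {ae mu, forall t, P t} -> ae_in T P.
Proof.
move=> [Z [mZ muZ hZ]]; exists Z; split => // t /= nP; apply: hZ => /= hP.
exact: nP.
Qed.

Lemma ae_in_exists T P : 0 < T -> ae_in T P -> exists t, 0 < t < T /\ P t.
Proof.
move=> T0 [Z [mZ muZ hZ]]; apply: contrapT => nex.
have : mu `]0, T[ = 0.
  apply: (@subset_measure0 _ _ _ mu _ Z) => //.
  move=> t; rewrite /= in_itv/= => tT; apply: hZ => /= h; apply: nex.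
  by exists t; split; rewrite ?tT//; exact: h.
by rewrite lebesgue_measure_itv/= lte_fin T0 sube0 => -[] /eqP; rewrite gt_eqF.
Qed.

End ae_in.

(** * Scalar weak derivatives and primitives *)

Section primitive.
Context {R : realType}.
Local Notation mu := (@lebesgue_measure R).
Implicit Types (f g : R -> R) (s t : R).

(** Applied to functions extended by zero off [(0, T)], which makes it continuous on the whole line
    and constant outside the interval. *)
Definition primitive f t : R := \int[mu]_(x in `]-oo, t]) f x.

Lemma integrableW (D : set (measurableTypeR R)) f : measurable D ->
  mu.-integrable setT (EFin \o f) -> mu.-integrable D (EFin \o f).
Proof. by move=> mD; exact: integrableS. Qed.

Lemma primitiveB f s t : mu.-integrable setT (EFin \o f) -> s <= t ->
  primitive f t - primitive f s = \int[mu]_(x in `]s, t]) f x.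
Proof.
move=> intf st; apply: Rintegral_itvB => //.
by apply: integrableW => //; exact: measurable_itv.
Qed.

Lemma primitive_continuous f : mu.-integrable setT (EFin \o f) ->
  continuous (primitive f).
Proof.
move=> intf t; have t11 : t - 1 < t + 1 by lra.
have ft11 : mu.-integrable `[t - 1, t + 1] (EFin \o f).
  by apply: integrableW => //; exact: measurable_itv.
have tin : t \in `]t - 1, t + 1[ by rewrite in_itv /=; apply/andP; split; lra.
have e x : t - 1 <= x ->
    primitive f (t - 1) + parameterized_integral mu (t - 1) x f = primitive f x.
  move=> t1x; rewrite /parameterized_integral -Rintegral_itv_obnd_cbnd.
    by rewrite -primitiveB// addrC subrK.
  by apply: integrableW => //; exact: measurable_itv.
have h : (primitive f (t - 1) + parameterized_integral mu (t - 1) x f)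
    @[x --> t] --> primitive f (t - 1) + parameterized_integral mu (t - 1) t f.
  apply: cvgD; first exact: cvg_cst.
  exact: (within_continuous_continuous t11
    (parameterized_integral_continuous (ltW t11) ft11) tin).
rewrite /continuous_at -(e t); last by lra.
apply: cvg_trans h; apply: near_eq_cvg; near=> x; rewrite e//.
by rewrite ltW//; near: x; apply: lt_nbhsr; lra.
Unshelve. all: by end_near. Qed.

Lemma integrable_locally_integrable f : mu.-integrable setT (EFin \o f) ->
  locally_integrable setT f.
Proof.
by move=> intf; have := integrable_locally measurableT intf; rewrite patch_setT.
Qed.

Lemma primitive_ae_derivable f : mu.-integrable setT (EFin \o f) ->
  {ae mu, forall t, is_derive t 1 (primitive f) (f t)}.
Proof.
move=> intf; have := @FTC1Ny R f _ (integrable_locally_integrable intf).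
have ify y : mu.-integrable `]-oo, y] (EFin \o f).
  by apply: integrableW => //; exact: measurable_itv.
move=> /(_ ify); apply: filterS; first exact: (ae_filter_ringOfSetsType mu).
move=> t [df f'].
by split => //; rewrite -f' derive1E.
Qed.

Lemma kern_cvg (u : R -> R) s (r : nat -> R) : (forall n, 0 < r n) ->
  r n @[n --> \oo] --> (0 : R) -> mu.-integrable setT (EFin \o u) ->
  lebesgue_pt u s ->
  \int[mu]_x (u x * kern s (r n) x) @[n --> \oo] --> u s.
Proof.
move=> r0 rcvg iu us; have [M M0 hM] := @kern_davg R.
have rr0 : (r n + r n) @[n --> \oo] --> (0 : R)^'+.
  have rr : (r n + r n) @[n --> \oo] --> (0 : R).
    by rewrite -[X in _ --> X](addr0 0); exact: cvgD.
  move=> A [e/= e0 eA].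
  have rre : \forall n \near \oo, ball 0 e (r n + r n).
    exact: (rr _ (nbhsx_ballx (0 : R) e e0)).
  suff : \forall n \near \oo, A (r n + r n) by [].
  by apply: filterS rre => n ne; apply: eA => //; rewrite addr_gt0.
have lim0 : (`|\int[mu]_x (u x * kern s (r n) x) - u s|%:E @[n --> \oo] --> 0)%E.
  apply: (@squeeze_cvge _ _ _ _ (fun=> 0%E) _
      (fun n => (M%:E * davg u s (r n + r n))%E)).
  - by apply: nearW => n; rewrite lee_fin normr_ge0/= hM.
  - exact: cvg_cst.
  - rewrite -[X in _ --> X](mule0 M%:E); apply: cvgeZl => //.
    exact: (cvg_comp _ _ rr0 us).
move/fine_cvg : lim0 => /= /cvgr0Pnorm_lt lim0.
apply/cvgrPdist_lt => e e0; near=> n; rewrite distrC -[ltLHS]normr_id.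
by near: n; exact: lim0.
Unshelve. all: by end_near. Qed.

Lemma test_function_step (T s t r : R) : 0 < s -> s < t -> 0 < r -> t + r < T ->
  test_function T (fun x => step s r x - step t r x).
Proof.
move=> s0 st r0 trT; split.
  apply: differentiable_times_derive1n => k; apply: differentiable_timesD.
    exact: differentiable_times_step.
  have -> : (fun x => - step t r x) = (fun x => -1 * step t r x).
    by apply/funext => x; rewrite mulN1r.
  apply: differentiable_timesM; first exact: differentiable_times_cst.
  exact: differentiable_times_step.
exists s, (t + r); split => // x /negP; rewrite negb_and -!ltNge.
move=> /orP[xs|trx].
  by rewrite !step_eq0 ?subrr ?(ltW xs)// ltW// (lt_trans xs).
by rewrite !step_eq1 ?subrr ?(ltW trx)//; lra.
Qed.

Lemma step_le1 s r x : `|step s r x| <= 1.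
Proof. by rewrite ger0_norm ?smooth_step_ge0// smooth_step_le1. Qed.

Lemma step_cvg s x (r : nat -> R) : (forall n, 0 < r n) ->
  r n @[n --> \oo] --> (0 : R) ->
  step s (r n) x @[n --> \oo] --> ((s < x)%R%:R : R).
Proof.
move=> r0 rcvg; have [sx|xs] := ltP s x; last first.
  apply: cvg_near_cst; apply: nearW => n; exact: step_eq0.
apply: cvg_near_cst; near=> n; apply: step_eq1 => //.
rewrite -lerBrDl; near: n.
have xs0 : 0 < x - s by rewrite subr_gt0.
have /cvgr0Pnorm_le/(_ _ xs0) := rcvg.
by apply: filterS => n; rewrite ger0_norm// ltW.
Unshelve. all: by end_near. Qed.

(** The test function [step s r - step t r] has derivative [kern s r - kern t r], so the left side
    of the weak identity tends to [u s - u t]. The test function itself tends to the indicator of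
    []s, t]] and is bounded by 2, so the right side converges by domination. *)
Lemma weak_derivative_lebesgue_pt (T : R) (u du : R -> R) :
  let D := `]0, T[%classic : set (measurableTypeR R) in
  mu.-integrable D (EFin \o u) -> mu.-integrable D (EFin \o du) ->
  weak_derivative T u du ->
  forall s t, 0 < s -> s < t -> t < T ->
    lebesgue_pt (u \_ D) s -> lebesgue_pt (u \_ D) t ->
  u t - u s = primitive (du \_ D) t - primitive (du \_ D) s.
Proof.
move=> D iu idu udu s t s0 st tT us ut.
have mD : measurable D by exact: measurable_itv.
set U := u \_ D in us ut *; set V := du \_ D.
have iU : mu.-integrable setT (EFin \o U).
  by rewrite -restrict_EFin; exact/(integrable_mkcond _ mD).
have iV : mu.-integrable setT (EFin \o V).
  by rewrite -restrict_EFin; exact/(integrable_mkcond _ mD).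
(* The denominator starts at 2, which keeps [t + r n] strictly below [T] even for [n = 0]. *)
pose r n : R := (T - t) / n.+2%:R.
have r0 n : 0 < r n by rewrite divr_gt0// subr_gt0.
have rT n : t + r n < T.
  by rewrite addrC -ltrBrDr ltr_pdivrMr// ltr_pMr ?subr_gt0// ltr1n.
have rcvg : r n @[n --> \oo] --> (0 : R).
  rewrite -[X in _ --> X](mulr0 (T - t)); apply: cvgM; first exact: cvg_cst.
  by have /(cvg_comp _ _ (cvg_addnr 1)) := @cvg_harmonic R; apply: cvg_trans;
    apply: near_eq_cvg; apply: nearW => n; rewrite /= /harmonic /= addn1.
have lhs n : \int[mu]_(x in D)
    (u x * derive1 (fun x => step s (r n) x - step t (r n) x) x) =
    \int[mu]_x (U x * kern s (r n) x) - \int[mu]_x (U x * kern t (r n) x).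
  have [M M0 hM] := @kern_bounded R.
  have ik z : mu.-integrable setT (EFin \o (fun x => U x * kern z (r n) x)).
    by apply: integrableM_bounded => //; [exact: measurable_kern|move=> x; exact: hM].
  rewrite -RintegralB// Rintegral_mkcond; apply: eq_Rintegral => x _.
  rewrite -mulrBr /U /patch; case: ifPn => // _; last by rewrite mul0r.
  congr (_ * _); rewrite derive1E; apply: derive_val.
  by apply: is_deriveB; exact: is_derive_step.
have rhs : \int[mu]_(x in D)
    (du x * (step s (r n) x - step t (r n) x)) @[n --> \oo] -->
    primitive V t - primitive V s.
  rewrite primitiveB ?(ltW st)// Rintegral_mkcond.
  under eq_fun do rewrite Rintegral_mkcond.
  have itv : (fun x => V x * ((s < x)%R%:R - (t < x)%R%:R)) = V \_ `]s, t].
    apply/funext => x; rewrite [RHS]/patch.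
    have [/set_mem|/negP xst] := ifPn.
      by rewrite /= in_itv/= => /andP[-> xt]; rewrite ltNge xt subr0 mulr1.
    case: ltP => sx; last by rewrite [t < x]ltNge (le_trans sx (ltW st))// subr0 mulr0.
    case: ltP => tx; first by rewrite subrr mulr0.
    by exfalso; apply: xst; apply/mem_set; rewrite /= in_itv/= sx.
  have mstep n : measurable_fun setT (fun x : measurableTypeR R =>
      step s (r n) x - step t (r n) x).
    by apply: measurable_funB; exact: measurable_step.
  have le2 n x : `|step s (r n) x - step t (r n) x| <= 2.
    rewrite (le_trans (ler_normB _ _))//.
    by rewrite (le_trans (lerD (step_le1 _ _ _) (step_le1 _ _ _)))//; lra.
  have iD n := integrableM_bounded measurableT iV (mstep n) (le2 n).
  have ilim : mu.-integrable setT (EFin \o V \_ `]s, t]).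
    have mst : measurable (`]s, t]%classic : set (measurableTypeR R)).
      exact: measurable_itv.
    by rewrite -restrict_EFin; apply/(integrable_mkcond _ mst); exact: integrableW.
  have key : (\int[mu]_x (V x * (step s (r n) x - step t (r n) x))%:E)%E
      @[n --> \oo] -->
      (\int[mu]_x (V \_ `]s, t]) x)%:E.
    rewrite /Rintegral fineK; last exact: integrable_fin_num ilim.
    rewrite -itv.
    apply: (@dominated_cvg _ _ _ mu setT measurableT _ _
      (fun x => (2 * `|V x|)%:E)).
    - by move=> n; case/integrableP: (iD n).
    - move=> x _; apply: cvg_EFin; first exact: nearW.
      apply: cvgM; first exact: cvg_cst.
      by apply: cvgB; exact: step_cvg.
    - by [].
    - have := integrableZl measurableT 2 (integrable_norm iV).
      by apply: eq_integrable.
    - by move=> n x _; rewrite lee_fin normrM mulrC ler_wpM2r.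
  have : _ --> _ := fine_cvg key; rewrite -Rintegral_mkcond.
  set F := fine \o _; set G := (fun n : nat => _).
  suff -> : F = G by exact.
  apply/funext => n; apply: eq_Rintegral => x _; rewrite /V /patch.
  by case: ifPn; rewrite ?mul0r.
have lim1 := cvgB (kern_cvg r0 rcvg iU us) (kern_cvg r0 rcvg iU ut).
have lim2 : \int[mu]_(x in D)
    (u x * derive1 (fun x => step s (r n) x - step t (r n) x) x)
    @[n --> \oo] --> U s - U t.
  by under eq_fun do rewrite lhs; exact: lim1.
have lim3 : \int[mu]_(x in D)
    (u x * derive1 (fun x => step s (r n) x - step t (r n) x) x)
    @[n --> \oo] --> - (primitive V t - primitive V s).
  under eq_fun => n do rewrite (udu _ (test_function_step s0 st (r0 n) (rT n))).
  exact: cvgN rhs.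
have := cvg_unique (@Rhausdorff R) lim2 lim3.
have UE z : 0 < z -> z < T -> U z = u z.
  by move=> z0 zT; rewrite /U /patch mem_set// /D /= in_itv/= z0.
have t0 := lt_trans s0 st; have sT := lt_trans st tT.
by rewrite !UE// => h; rewrite -(opprB (u s)) h opprK.
Qed.

(** Lebesgue points have full measure: one of them, [s0], serves as base point and fixes the
    constant. *)
Lemma weak_derivative_primitive (T : R) (u du : R -> R) : 0 < T ->
  let D := `]0, T[%classic : set (measurableTypeR R) in
  mu.-integrable D (EFin \o u) -> mu.-integrable D (EFin \o du) ->
  weak_derivative T u du ->
  exists c, ae_in T (fun t => u t = c + primitive (du \_ D) t).
Proof.
move=> T0 D iu idu udu.
have aeL := lebesgue_differentiation (integrable_locally (measurable_itv _) iu).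
have [s0 [/andP[s00 s0T] hs0]] := ae_in_exists T0 (ae_inW T aeL).
have key := weak_derivative_lebesgue_pt iu idu udu.
exists (u s0 - primitive (du \_ D) s0).
apply: ae_inS (ae_inW T aeL) => t /andP[t0 tT] ht.
have [st|ts|->] := ltgtP s0 t; last by lra.
- by have := key _ _ s00 st tT hs0 ht; rewrite -/D; lra.
- by have := key _ _ t0 ts s0T ht hs0; rewrite -/D; lra.
Qed.

End primitive.

(** * Bounded bilinear maps and inner products *)

Section bounded_bilinear.
Context {R : realType} (V W : normedModType R) (B : V -> W -> R) (M : R).
Hypothesis BBl : forall x y z, B (x - y) z = B x z - B y z.
Hypothesis BBr : forall x y z, B z (x - y) = B z x - B z y.
Hypothesis BM : forall x y, `|B x y| <= M * `|x| * `|y|.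

Lemma bilinear_cvg (I : Type) (F : set_system I) (FF : Filter F)
    (f : I -> V) (g : I -> W) a c : f @ F --> a -> g @ F --> c ->
  B (f i) (g i) @[i --> F] --> B a c.
Proof.
move=> fa gc.
pose bnd i := M * `|f i - a| * `|g i| + M * `|a| * `|g i - c|.
have bnd0 : bnd i @[i --> F] --> (0 : R).
  have -> : 0 = M * `|a - a| * `|c| + M * `|a| * `|c - c|.
    by rewrite !subrr !normr0 !(mulr0, mul0r) addr0.
  apply: cvgD; apply: cvgM; try apply: cvgM; try exact: cvg_cst.
  - by apply: cvg_norm; apply: cvgB => //; exact: cvg_cst.
  - exact: cvg_norm.
  - by apply: cvg_norm; apply: cvgB => //; exact: cvg_cst.
apply/subr_cvg0; apply: (@squeeze_cvgr _ _ _ _ (fun i => - bnd i) bnd) => //.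
- apply: nearW => i; rewrite -ler_norml.
  have -> : B (f i) (g i) - B a c = B (f i - a) (g i) + B a (g i - c).
    by rewrite BBl BBr; ring.
  by rewrite (le_trans (ler_normD _ _))// lerD.
- by rewrite -[X in _ --> X]oppr0; exact: cvgN.
Qed.

End bounded_bilinear.

Section inner_product.
Context {R : realType} {H : normedModType R} {ip : H -> H -> R}.
Hypothesis hip : inner_product ip.
Implicit Types (a : R) (x y z : H).

Lemma ipC x y : ip x y = ip y x.
Proof. by have [_ + _] := hip; exact. Qed.

Lemma ipxx x : ip x x = `|x| ^+ 2.
Proof. by have [_ _ +] := hip; exact. Qed.

Lemma ipDl x y z : ip (x + y) z = ip x z + ip y z.
Proof. by have [h _ _] := hip; have := h 1 x y z; rewrite scale1r mul1r. Qed.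

Lemma ip0l z : ip 0 z = 0.
Proof. by have := ipDl 0 0 z; rewrite addr0; lra. Qed.

Lemma ipZl a x z : ip (a *: x) z = a * ip x z.
Proof. by have [h _ _] := hip; have := h a x 0 z; rewrite addr0 ip0l addr0. Qed.

Lemma ipNl x z : ip (- x) z = - ip x z.
Proof. by rewrite -scaleN1r ipZl mulN1r. Qed.

Lemma ipBl x y z : ip (x - y) z = ip x z - ip y z.
Proof. by rewrite ipDl ipNl. Qed.

Lemma ipDr x y z : ip z (x + y) = ip z x + ip z y.
Proof. by rewrite ipC ipDl ![ip _ z]ipC. Qed.

Lemma ip0r z : ip z 0 = 0. Proof. by rewrite ipC ip0l. Qed.

Lemma ipZr a x z : ip z (a *: x) = a * ip z x.
Proof. by rewrite ipC ipZl [ip _ z]ipC. Qed.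

Lemma ipNr x z : ip z (- x) = - ip z x.
Proof. by rewrite ipC ipNl [ip _ z]ipC. Qed.

Lemma ipBr x y z : ip z (x - y) = ip z x - ip z y.
Proof. by rewrite ipDr ipNr. Qed.

Lemma ip_suml (I : Type) (s : seq I) (F : I -> H) z :
  ip (\sum_(i <- s) F i) z = \sum_(i <- s) ip (F i) z.
Proof.
by elim: s => [|i s IH]; rewrite ?big_nil ?ip0l// !big_cons ipDl IH.
Qed.

Lemma ip_sumr (I : Type) (s : seq I) (F : I -> H) z :
  ip z (\sum_(i <- s) F i) = \sum_(i <- s) ip z (F i).
Proof. by rewrite ipC ip_suml; apply: eq_bigr => i _; rewrite ipC. Qed.

Lemma ip_eq0 x : ip x x = 0 -> x = 0.
Proof. by rewrite ipxx => /eqP; rewrite sqrf_eq0 normr_eq0 => /eqP. Qed.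

(** Cauchy-Schwarz, from the nonnegative squared norm of [x] minus its projection onto [y]. *)
Lemma ip_norm x y : `|ip x y| <= `|x| * `|y|.
Proof.
have [->|y0] := eqVneq y 0; first by rewrite ip0r normr0 normr0 mulr0.
have n0 : 0 < `|y| ^+ 2 by rewrite exprn_gt0// normr_gt0.
have : 0 <= ip (x - (ip x y / `|y| ^+ 2) *: y) (x - (ip x y / `|y| ^+ 2) *: y).
  by rewrite ipxx sqr_ge0.
rewrite ipBl !ipBr !ipZl !ipZr [ip y x]ipC !ipxx => h.
have {}h : 0 <= `|x| ^+ 2 - ip x y ^+ 2 / `|y| ^+ 2.
  move: h; congr (0 <= _); field; rewrite normr_eq0//.
have : ip x y ^+ 2 <= (`|x| * `|y|) ^+ 2.
  by rewrite exprMn -ler_pdivrMr//; lra.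
by rewrite -[X in X <= _]real_normK ?num_real// ler_sqr ?nnegrE ?mulr_ge0.
Qed.

Lemma ip_cvg (I : Type) (F : set_system I) (FF : Filter F) (f g : I -> H) x y :
  f @ F --> x -> g @ F --> y -> ip (f i) (g i) @[i --> F] --> ip x y.
Proof.
apply: (@bilinear_cvg R H H ip 1) => *; rewrite ?ipBl ?ipBr//.
by rewrite mul1r ip_norm.
Qed.

(* [2 (x - y, x) = |x|^2 - |y|^2 + |x - y|^2] *)
Lemma ip_subl_ge x y : `|x| ^+ 2 - `|y| ^+ 2 <= 2 * ip (x - y) x.
Proof.
have := sqr_ge0 `|x - y|; rewrite -!ipxx !ipBl !ipBr [ip y x]ipC; lra.
Qed.

End inner_product.

(** * Backward differences of scalar functions *)

Section difference_quotients.
Context {R : realType}.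
Local Notation mu := (@lebesgue_measure R).
Implicit Types (F : R -> R) (t h T M : R).

Lemma integrable_itvoo_continuous F T : continuous F ->
  mu.-integrable `]0, T[ (EFin \o F).
Proof.
move=> cF; apply: (@integrableS _ _ _ mu `[0, T]) => //.
  exact: subset_itv_oo_cc.
apply: continuous_compact_integrable; first exact: segment_compact.
exact: continuous_subspaceT.
Qed.

Lemma Rintegral_itvoo_cc F T : mu.-integrable `[0, T] (EFin \o F) ->
  \int[mu]_(t in `]0, T[) F t = \int[mu]_(t in `[0, T]) F t.
Proof.
move=> iF; rewrite Rintegral_itv_bndo_bndc; last first.
  apply: (@integrableS _ _ _ mu `[0, T]) => //; exact: subset_itv_oo_cc.
rewrite Rintegral_itv_obnd_cbnd//.
by apply: (@integrableS _ _ _ mu `[0, T]) => //; exact: subset_itv_oc_cc.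
Qed.

Lemma continuous_antiderivative F (a b : R) : continuous F -> a < b ->
  exists P : R -> R, forall x : R, a < x < b -> is_derive x 1 P (F x).
Proof.
move=> cF ab; exists (fun x => \int[mu]_(t in `[a, x]) F t) => x /andP[ax xb].
have iF : mu.-integrable `[a, b] (EFin \o F).
  apply: continuous_compact_integrable; first exact: segment_compact.
  exact: continuous_subspaceT.
have [dF F'] := continuous_FTC1_closed xb iF ax (cF x).
by split => //; rewrite -F' derive1E.
Qed.

Lemma continuous_shift F h : continuous F -> continuous (fun t => F (t - h)).
Proof.
move=> cF t; apply: (@continuous_comp _ _ _ (fun t => t - h)); last exact: cF.
by apply: cvgB => //; exact: cvg_cst.
Qed.

(** The integral telescopes to that of [F] over [[T - h, T]] minus that over [[- h, 0]]. By the mean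
    value theorem each is [h] times a value of [F]: the former value is at most [M], the latter is
    taken left of 0 and equals [F 0]. *)
Lemma integral_backward_difference F h T M : continuous F -> 0 < h -> 0 < T ->
  (forall t, F t <= M) -> (forall t, t <= 0 -> F t = F 0) ->
  \int[mu]_(t in `]0, T[) (F t - F (t - h)) <= h * (M - F 0).
Proof.
move=> cF h0 T0 FM F0.
have cdF : continuous (fun t => F t - F (t - h)).
  by move=> t; apply: cvgB; [exact: cF|exact: continuous_shift].
(* The margins of length 1 make [P] differentiable at the end points [- h] and [T] too. *)
have [P dP] : exists P : R -> R, forall x : R, - h - 1 < x < T + 1 ->
  is_derive x 1 P (F x) by apply: continuous_antiderivative => //; lra.
have dPh x : - 1 < x < T + 1 -> is_derive x 1 (fun x => P x - P (x - h))
    (F x - F (x - h)).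
  move=> xT; apply: is_deriveB; first by apply: dP; lra.
  rewrite -[F (x - h)]mulr1; apply: (@is_derive1_comp R P (fun x => x - h)).
    by apply: dP; lra.
  rewrite -[X in is_derive _ _ _ X]subr0; apply: is_deriveB.
have cP x : - h - 1 < x < T + 1 -> {for x, continuous P}.
  move=> xT; apply: differentiable_continuous; apply/derivable1_diffP.
  exact: (@ex_derive _ _ _ _ _ _ _ (dP x xT)).
have cPh x : - 1 < x < T + 1 -> {for x, continuous (fun x => P x - P (x - h))}.
  move=> xT; apply: differentiable_continuous; apply/derivable1_diffP.
  exact: (@ex_derive _ _ _ _ _ _ _ (dPh x xT)).
rewrite Rintegral_itvoo_cc; last first.
  apply: continuous_compact_integrable; first exact: segment_compact.
  exact: continuous_subspaceT.
rewrite /Rintegral (@continuous_FTC2 _ _ (fun x => P x - P (x - h)))//=.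
- have mvt a : - h <= a -> a + h <= T ->
      exists2 c, a < c < a + h & P (a + h) - P a = F c * h.
    move=> ha aT.
    have [|||c] := @MVT R P F a (a + h).
    + by lra.
    + by move=> x; rewrite in_itv/= => /andP[? ?]; apply: dP; lra.
    + apply: continuous_in_subspaceT => x; rewrite inE/= in_itv/= => /andP[? ?].
      by apply: cP; lra.
    + rewrite in_itv/= => ac; rewrite [a + h - a]addrC addrA addNr add0r => e.
      by exists c.
  have [||c1 _] := mvt (T - h); [lra..|rewrite subrK => e1].
  have [||c2 /andP[_ c20]] := mvt (- h); [lra..|rewrite addNr => e2].
  rewrite sub0r (_ : P T - P (T - h) - (P 0 - P (- h)) = F c1 * h - F c2 * h).
    rewrite (F0 c2); last by lra.
    by rewrite -mulrBl mulrC ler_pM2l// lerD2r.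
  by rewrite e1 e2.
- exact: continuous_subspaceT.
- split.
  + move=> x; rewrite in_itv/= => /andP[? ?].
    by apply: (@ex_derive _ _ _ _ _ _ _ (dPh x _)); lra.
  + by apply/cvg_at_right_filter/cPh; lra.
  + by apply/cvg_at_left_filter/cPh; lra.
- move=> x; rewrite in_itv/= => /andP[? ?]; rewrite derive1E.
  by apply: (@derive_val _ _ _ _ _ _ _ (dPh x _)); lra.
Qed.

Lemma backward_difference_cvg F t a (h : nat -> R) : (forall n, 0 < h n) ->
  h n @[n --> \oo] --> (0 : R) -> is_derive t 1 F a ->
  (F t - F (t - h n)) / h n @[n --> \oo] --> a.
Proof.
move=> h0 hcvg [dF <-].
have hN : - h n @[n --> \oo] --> (0 : R)^'.
  move=> A [e/= e0 eA].
  have he : \forall n \near \oo, ball 0 e (- h n).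
    have hN0 : - h n @[n --> \oo] --> (0 : R).
      by rewrite -[X in _ --> X]oppr0; exact: cvgN.
    exact: (hN0 _ (nbhsx_ballx (0 : R) e e0)).
  suff : \forall n \near \oo, A (- h n) by [].
  by apply: filterS he => n ne; apply: eA => //=; rewrite oppr_eq0 gt_eqF.
have dcvg : (fun h => h^-1 *: (F (h *: 1 + t) - F t)) @ 0^' --> 'D_1 F t by exact: dF.
have := cvg_comp _ _ hN dcvg; rewrite /comp/=.
rewrite (_ : (fun n => _) = fun n => (F t - F (t - h n)) / h n)//.
apply/funext => n; rewrite -![_ *: _]/(_ * _) mulr1 [- h n + t]addrC.
by field; rewrite gt_eqF.
Qed.

End difference_quotients.

(** * Countable unions of exceptional sets *)

Section ae_countable.
Context {R : realType}.

Lemma ae_in_itvP (T : R) (P : R -> Prop) : ae_in T P ->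
  {ae @lebesgue_measure R, forall t, `]0, T[%classic t -> P t}.
Proof.
move=> [Z [mZ muZ hZ]]; exists Z; split => // t /= nP; apply: hZ => /= hP.
Qed.

Lemma ae_in_seq (X : eqType) (T : R) (s : seq X) (P : X -> R -> Prop) :
  (forall x, ae_in T (P x)) -> ae_in T (fun t => forall x, x \in s -> P x t).
Proof.
move=> hP; elim: s => [|x s IH]; first by apply: ae_inW; exact: aeW.
apply: ae_inS (ae_inI (hP x) IH) => t _ [Px Ps] y.
by rewrite inE => /orP[/eqP ->//|]; exact: Ps.
Qed.

Lemma ae_in_foralln (T : R) (P : nat -> R -> Prop) :
  (forall n, ae_in T (P n)) -> ae_in T (fun t => forall n, P n t).
Proof.
move=> hP; have := ae_foralln hP.
by apply: filterS => t Pt tT n; exact: Pt.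
Qed.

(** The null set attached to [x] varies with [x], but functions with finite ranges meet only
    countably many [x]. This is how a statement about fixed vectors is applied to moving ones. *)
Lemma ae_in_simple (X : choiceType) (T : R) (s : nat -> R -> X)
    (P : X -> R -> Prop) : (forall n, finite_set (range (s n))) ->
  (forall x, ae_in T (P x)) -> ae_in T (fun t => forall n, P (s n t) t).
Proof.
move=> sfin hP; apply: ae_in_foralln => n.
have [l sl] := (finite_seqP _).1 (sfin n).
apply: ae_inS (ae_in_seq l hP) => t _; apply.
by have : range (s n) (s n t) by []; rewrite sl.
Qed.

End ae_countable.

(** * The energy inequality by Fatou's lemma *)

Section energy.
Context {R : realType}.
Local Notation mu := (@lebesgue_measure R).
Variables (Q H : normedModType R) (ip : H -> H -> R) (hip : inner_product ip).
Variable iota : {linear Q -> H}.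
Variables (T : R) (T0 : 0 < T).
Let D : set (measurableTypeR R) := `]0, T[%classic.
Variables (u : R -> Q) (s : nat -> R -> Q).
Hypothesis sfin : forall n, finite_set (range (s n)).
Hypothesis scvg : ae_in T (fun t => s n t @[n --> \oo] --> u t).
Variable U : R -> H.
Hypothesis cU : continuous U.
Hypothesis U0 : forall t : R, t <= 0 -> U t = U 0.
Hypothesis Uu : ae_in T (fun t => U t = iota (u t)).
(** [g t] plays the functional [dt e^c(t)] on [Q] and [gam t] a bound for its operator norm. The
    hypothesis [gU] is the weak derivative in integrated form, one vector [z] at a time. *)
Variables (g : R -> Q -> R) (gam : R -> R).
Hypothesis gB : forall t z z', g t (z - z') = g t z - g t z'.
Hypothesis g_le : forall (t : R) (z : Q), 0 < t < T -> `|g t z| <= gam t * `|z|.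
Hypothesis ig : forall z, mu.-integrable D (EFin \o g^~ z).
Hypothesis igam : mu.-integrable D (EFin \o gam).
Hypothesis igam2 : mu.-integrable D (EFin \o (fun t => gam t ^+ 2)).
Hypothesis iu2 : mu.-integrable D (EFin \o (fun t => `|u t| ^+ 2)).
Hypothesis gU : forall z t r, ip (U t - U r) (iota z) =
  primitive ((g^~ z) \_ D) t - primitive ((g^~ z) \_ D) r.

Let mD : measurable D. Proof. exact: measurable_itv. Qed.

Let DE t : (t \in D) = (0 < t < T).
Proof. by rewrite /D mem_setE in_itv. Qed.

Let integrable_patch (f : R -> R) : mu.-integrable D (EFin \o f) ->
  mu.-integrable setT (EFin \o f \_ D).
Proof. by move=> If; rewrite -restrict_EFin; exact/(integrable_mkcond _ mD). Qed.

Let P z := primitive ((g^~ z) \_ D).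
Let Pgam := primitive (gam \_ D).
Let G := primitive ((fun t => gam t ^+ 2) \_ D).

(** One function [Pgam] controls the increments of [P z] for all [z] at once; the null set where
    [Pgam] fails to be differentiable does not depend on [z]. *)
Let P_le (z : Q) (r t : R) : r <= t -> `|P z t - P z r| <= (Pgam t - Pgam r) * `|z|.
Proof.
move=> rt; have ipg := integrable_patch (ig z); have ipgam := integrable_patch igam.
have mrt : measurable (`]r, t]%classic : set (measurableTypeR R)).
  exact: measurable_itv.
rewrite /P /Pgam !primitiveB// (le_trans (le_normr_Rintegral _ _))//.
  exact: integrableW.
rewrite -RintegralZr//; last exact: integrableW.
apply: le_Rintegral => //.
- by have := integrable_norm (integrableW mrt ipg); apply: eq_integrable.
- by have := integrableZr mrt `|z| (integrableW mrt ipgam); apply: eq_integrable.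
- move=> x _; rewrite /patch DE; case: ifPn => xT; first exact: g_le.
  by rewrite normr0 mul0r.
Qed.

Let P_leG (z : Q) (r t : R) : r <= t -> P z t - P z r <= 2^-1 * (G t - G r) +
  2^-1 * (t - r) * `|z| ^+ 2.
Proof.
move=> rt; have ipg := integrable_patch (ig z); have iG := integrable_patch igam2.
have mrt : measurable (`]r, t]%classic : set (measurableTypeR R)).
  exact: measurable_itv.
have murt : mu (`]r, t]%classic : set (measurableTypeR R)) = (t - r)%:E.
  rewrite lebesgue_measure_itv/= lte_fin; case: ltP => // tr.
  by rewrite (_ : t = r) ?subrr//; apply/eqP; rewrite eq_le tr rt.
have ic : mu.-integrable (`]r, t]%classic : set (measurableTypeR R))
    (EFin \o cst (2^-1 * `|z| ^+ 2)).
  apply: (@integrableS _ _ _ mu `[r, t]) => //; first exact: subset_itv_oc_cc.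
  apply: continuous_compact_integrable; first exact: segment_compact.
  by apply: continuous_subspaceT => x; exact: cvg_cst.
have iGh : mu.-integrable (`]r, t]%classic : set (measurableTypeR R))
    (EFin \o (fun x => 2^-1 * ((fun t => gam t ^+ 2) \_ D) x)).
  by have := integrableZl mrt 2^-1 (integrableW mrt iG); apply: eq_integrable.
rewrite /P /G !primitiveB// -RintegralZl//; last exact: integrableW.
have -> : 2^-1 * (t - r) * `|z| ^+ 2 =
    \int[mu]_(x in `]r, t]) (2^-1 * `|z| ^+ 2).
  rewrite Rintegral_cst// (_ : fine _ = t - r); first by ring.
  exact: (congr1 fine murt).
rewrite -RintegralD//; apply: le_Rintegral => //; first exact: integrableW.
  by have := integrableD mrt iGh ic; apply: eq_integrable.
move=> x _; rewrite /patch DE; case: ifPn => xT.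
  have := le_trans (ler_norm _) (g_le z xT).
  have := sqr_ge0 (gam x - `|z|); lra.
by rewrite mulr0 add0r mulr_ge0.
Qed.

Let h n : R := n.+1%:R^-1.
Let h0 n : 0 < h n. Proof. by rewrite invr_gt0. Qed.
Let hcvg : h n @[n --> \oo] --> (0 : R). Proof. exact: cvg_harmonic. Qed.

(* Young: [g t z <= gam t ^ 2 / 2 + |z| ^ 2 / 2], integrated over [(t - h, t)] at
   the fixed vector [z = u t], makes this corrected quotient nonnegative. *)
Let pre (n : nat) (t : R) : R := 2^-1 * ((G t - G (t - h n)) / h n) + 2^-1 * `|u t| ^+ 2
  - ip (U t - U (t - h n)) (U t) / h n.

Let energy_density (t : R) : R := 2^-1 * gam t ^+ 2 + 2^-1 * `|u t| ^+ 2 - g t (u t).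

Let pre_ge0 : ae_in T (fun t => forall n, 0 <= pre n t).
Proof.
apply: ae_inS Uu => t tT Ut n; rewrite /pre {2}Ut gU.
have th : t - h n <= t by rewrite gerBl ltW.
have := P_leG (u t) th; rewrite (_ : t - (t - h n) = h n); last by ring.
rewrite -/(P (u t)) => hP.
set x := G t - _ in hP *; set y := P _ t - _ in hP *.
have -> : 2^-1 * (x / h n) + 2^-1 * `|u t| ^+ 2 - y / h n =
    (2^-1 * x + 2^-1 * h n * `|u t| ^+ 2 - y) / h n.
  by field; rewrite gt_eqF.
by rewrite divr_ge0 ?(ltW (h0 n))// subr_ge0.
Qed.

(** [P z] has derivative [g t z] off a null set depending on [z], while the vector [u t] moves with
    [t]. Differentiability is used only at the values [s n t]; the remainder [w = u t - s N t] is
    small, and its quotients are bounded by those of [Pgam] times the norm of [w]. *)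
Let pre_cvg : ae_in T (fun t => pre n t @[n --> \oo] --> energy_density t).
Proof.
have dP : ae_in T (fun t => forall n, is_derive t 1 (P (s n t)) (g t (s n t))).
  apply: (@ae_in_simple _ _ _ _ (fun z t => is_derive t 1 (P z) (g t z))) => // z.
  have := ae_inW T (primitive_ae_derivable (integrable_patch (ig z))).
  by apply: ae_inS => t tT; rewrite {2}/patch DE tT.
have dPgam : ae_in T (fun t => is_derive t 1 Pgam (gam t)).
  have := ae_inW T (primitive_ae_derivable (integrable_patch igam)).
  by apply: ae_inS => t tT; rewrite {2}/patch DE tT.
have dG : ae_in T (fun t => is_derive t 1 G (gam t ^+ 2)).
  have := ae_inW T (primitive_ae_derivable (integrable_patch igam2)).
  by apply: ae_inS => t tT; rewrite {2}/patch DE tT.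
have := ae_inI (ae_inI (ae_inI dP dPgam) (ae_inI dG scvg)) Uu.
apply: ae_inS => t tT [[[{}dP {}dPgam] [{}dG st]] Ut].
apply: cvgB.
  apply: cvgD; last exact: cvg_cst.
  by apply: cvgM; [exact: cvg_cst|exact: backward_difference_cvg dG].
apply/cvgrPdist_le => e e0.
(* [|gam t|] for [g t w] plus [|gam t| + 1] for the quotient at [w], the 1 being the tolerance in
   [A2]. *)
pose K := 2 * `|gam t| + 1.
have K0 : 0 < K by rewrite ltr_wpDl// mulr_ge0.
have [N hN] : exists N, `|u t - s N t| <= e / 2 / K.
  have e2 : 0 < e / 2 / K by rewrite !divr_gt0.
  move/cvgrPdist_le : st => /(_ _ e2)[N _ hN]; exists N; exact: hN (leqnn N).
have cvgz := backward_difference_cvg h0 hcvg (dP N).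
have cvggam := backward_difference_cvg h0 hcvg dPgam.
have e2 : 0 < e / 2 by rewrite divr_gt0.
near=> n.
have A1 : `|g t (s N t) - (P (s N t) t - P (s N t) (t - h n)) / h n| <= e / 2.
  by near: n; move/cvgrPdist_le : cvgz; apply.
have A2 : `|gam t - (Pgam t - Pgam (t - h n)) / h n| <= 1.
  by near: n; move/cvgrPdist_le : cvggam; apply.
have th : t - h n <= t by rewrite gerBl ltW.
rewrite {2}Ut -{2}(subrK (s N t) (u t)) linearD/= (ipDr hip) !gU mulrDl.
rewrite -!/(P _); set z := s N t in A1 hN *; set w := u t - z.
have A3 : `|(P w t - P w (t - h n)) / h n| <= (`|gam t| + 1) * `|w|.
  rewrite normrM [X in _ * X]gtr0_norm ?invr_gt0//.
  rewrite ler_pdivrMr// (le_trans (P_le w th))// mulrAC ler_wpM2r//.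
  rewrite -ler_pdivrMr//; have := ler_norm (gam t).
  by move: A2; rewrite ler_norml => /andP[]; lra.
have A4 : `|g t w| <= `|gam t| * `|w|.
  by rewrite (le_trans (g_le w tT))// ler_wpM2r// ler_norm.
have -> : g t (u t) = g t w + g t z by rewrite gB subrK.
have A5 : K * `|w| <= e / 2.
  by rewrite mulrC -ler_pdivlMr.
have -> : g t w + g t z - ((P w t - P w (t - h n)) / h n +
    (P z t - P z (t - h n)) / h n) = g t w - (P w t - P w (t - h n)) / h n +
    (g t z - (P z t - P z (t - h n)) / h n) by ring.
rewrite (le_trans (ler_normD _ _))// (splitr e) lerD//.
rewrite (le_trans (ler_normB _ _))// (le_trans (lerD A4 A3))//.
by rewrite (le_trans _ A5)// /K; lra.
Unshelve. all: by end_near. Qed.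

Let cG : continuous G. Proof. exact/primitive_continuous/integrable_patch. Qed.

Let cW : continuous (fun t => `|U t| ^+ 2).
Proof.
by move=> t; apply: cvgM; apply: cvg_norm; exact: cU.
Qed.

Let cUU n : continuous (fun t => ip (U t - U (t - h n)) (U t)).
Proof.
move=> t; apply: (ip_cvg hip); last exact: cU.
apply: cvgB; first exact: cU.
apply: (@continuous_comp _ _ _ (fun t => t - h n) U); last exact: cU.
by apply: cvgB => //; exact: cvg_cst.
Qed.

Let G_le (t : R) : G t <= \int[mu]_(x in D) gam x ^+ 2.
Proof.
rewrite Rintegral_mkcond /G /primitive; have iG := integrable_patch igam2.
rewrite Rintegral_mkcond; apply: le_Rintegral => //.
- have mt : measurable (`]-oo, t]%classic : set (measurableTypeR R)).
    exact: measurable_itv.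
  by rewrite -restrict_EFin; apply/(integrable_mkcond _ mt); exact: integrableW.
- move=> x _; rewrite {1}/patch; case: ifPn => // _.
  by rewrite /patch; case: ifPn => // _; rewrite sqr_ge0.
Qed.

Let G_ge0 (t : R) : 0 <= G t.
Proof.
by apply: Rintegral_ge0 => x _; rewrite /patch; case: ifPn => // _; rewrite sqr_ge0.
Qed.

Let G_cst (t : R) : t <= 0 -> G t = G 0.
Proof.
move=> t0; apply/esym/eqP; rewrite -subr_eq0 /G primitiveB//; last exact: integrable_patch.
have -> : \int[mu]_(x in `]t, 0]) ((fun t => gam t ^+ 2) \_ D) x =
    \int[mu]_(x in `]t, 0]) (cst 0) x.
  apply: eq_Rintegral => x; rewrite mem_setE in_itv/= => /andP[_ x0].
  by rewrite /patch DE ltNge x0.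
by rewrite /Rintegral integral0.
Qed.

Let idG n : mu.-integrable D (EFin \o (fun t => G t - G (t - h n))).
Proof.
apply: integrable_itvoo_continuous => t; apply: cvgB; first exact: cG.
exact: continuous_shift.
Qed.

Let idW n : mu.-integrable D
  (EFin \o (fun t => - `|U t| ^+ 2 - - `|U (t - h n)| ^+ 2)).
Proof.
apply: (integrable_itvoo_continuous (F := fun t => _ - _)) => t; apply: cvgB.
  by apply: cvgN; exact: cW.
by apply: cvgN; exact: (continuous_shift cW).
Qed.

(** [pre] after the inner product is replaced through [ip_subl_ge]: apart from the [|u t|^2] term
    only backward differences of continuous scalar functions remain, and these can be integrated. *)
Let bound n t := (2^-1 / h n) * (G t - G (t - h n)) + 2^-1 * `|u t| ^+ 2 +
  (2^-1 / h n) * (- `|U t| ^+ 2 - - `|U (t - h n)| ^+ 2).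

Let i1 n : mu.-integrable D (EFin \o (fun t => (2^-1 / h n) * (G t - G (t - h n)))).
Proof. by have := integrableZl mD (2^-1 / h n) (idG n); apply: eq_integrable. Qed.

Let i2 : mu.-integrable D (EFin \o (fun t => 2^-1 * `|u t| ^+ 2)).
Proof. by have := integrableZl mD 2^-1 iu2; apply: eq_integrable. Qed.

Let i3 n : mu.-integrable D
  (EFin \o (fun t => (2^-1 / h n) * (- `|U t| ^+ 2 - - `|U (t - h n)| ^+ 2))).
Proof. by have := integrableZl mD (2^-1 / h n) (idW n); apply: eq_integrable. Qed.

Let i12 n : mu.-integrable D
  (EFin \o (fun t => (2^-1 / h n) * (G t - G (t - h n)) + 2^-1 * `|u t| ^+ 2)).
Proof. by have := integrableD mD (i1 n) i2; apply: eq_integrable. Qed.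

Let ibound n : mu.-integrable D (EFin \o bound n).
Proof. by have := integrableD mD (i12 n) (i3 n); apply: eq_integrable. Qed.

Let A := 2^-1 * \int[mu]_(t in D) gam t ^+ 2 +
  2^-1 * \int[mu]_(t in D) `|u t| ^+ 2 + 2^-1 * `|U 0| ^+ 2.

(** [integral_backward_difference] is applied to [G] with its total integral as upper bound, and to
    [- |U t|^2] with upper bound 0, which leaves exactly [|U 0|^2]. *)
Let bound_le n : \int[mu]_(t in D) bound n t <= A.
Proof.
rewrite /bound RintegralD// RintegralD// !RintegralZl// /A.
have hn := h0 n.
have hG := integral_backward_difference cG hn T0 G_le G_cst.
have cNW : continuous (fun t => - `|U t| ^+ 2) by move=> t; apply: cvgN; exact: cW.
have hW := @integral_backward_difference _ (fun t => - `|U t| ^+ 2) (h n) T 0 cNW hn T0.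
have {}hW := hW _ _.
apply: lerD; first apply: lerD => //.
- rewrite mulrAC -mulrA ler_wpM2l// ler_pdivrMr// mulrC.
  rewrite (le_trans hG)// ler_wpM2l ?(ltW hn)//.
  by have := G_ge0 0; lra.
- rewrite mulrAC -mulrA ler_wpM2l// ler_pdivrMr// mulrC.
  have {}hW := hW (fun t => _) (fun t => _).
  apply: le_trans (hW _ _) _ => [t|t t0|].
  + by rewrite oppr_le0 sqr_ge0.
  + by rewrite U0.
  + by rewrite sub0r opprK.
Qed.

Let pre_bound n t : pre n t <= bound n t.
Proof.
have b0 := h0 n; rewrite /pre /bound.
have -> : 2^-1 * ((G t - G (t - h n)) / h n) = 2^-1 / h n * (G t - G (t - h n)).
  by field; rewrite gt_eqF.
rewrite lerD2l.
have := ip_subl_ge hip (U t) (U (t - h n)).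
set a := ip _ _ => ha.
rewrite [leRHS]mulrAC -mulNr ler_wpM2r ?invr_ge0 ?(ltW b0)//.
by lra.
Qed.

Let mpre n : measurable_fun D (pre n).
Proof.
have mU : measurable_fun D (fun t => ip (U t - U (t - h n)) (U t)).
  apply/measurable_EFinP.
  by case/integrableP: (integrable_itvoo_continuous T (@cUU n)).
apply: measurable_funB.
  apply: measurable_funD.
    apply: measurable_funM => //; apply: measurable_funM => //.
    by apply/measurable_EFinP; case/integrableP: (idG n).
  by apply/measurable_EFinP; case/integrableP: i2.
exact: measurable_funM.
Qed.

(** Stated for a measurable [L] that agrees almost everywhere with the density: measurability comes
    with the lower limit and is not derived from [g t (u t)] itself. *)
Lemma energy_inequality : exists L : R -> \bar R,
  [/\ measurable_fun D L, forall t, (0 <= L t)%E,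
      ae_in T (fun t => L t = (2^-1 * gam t ^+ 2 + 2^-1 * `|u t| ^+ 2
                               - g t (u t))%:E)
    & (\int[mu]_(t in D) L t <=
       (2^-1 * \int[mu]_(t in D) (gam t ^+ 2)%R +
        2^-1 * \int[mu]_(t in D) (`|u t| ^+ 2)%R +
        2^-1 * `|U 0| ^+ 2)%R%:E)%E].
Proof.
(* Fatou's lemma asks for nonnegativity everywhere, and [pre] has it only almost everywhere, hence
   the positive part. *)
pose Phi n t := (Num.max 0 (pre n t))%:E.
have mPhi n : measurable_fun D (Phi n).
  by apply/measurable_EFinP; apply: measurable_maxr; [exact: measurable_cst|exact: mpre].
have Phi0 n t : (0 <= Phi n t)%E by rewrite lee_fin le_max lexx.
exists (fun t => limn_einf (Phi^~ t)); split.
- rewrite [X in measurable_fun _ X](_ : _ =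
      fun t => - limn_esup ((fun n t => - Phi n t) ^~ t))%E.
    apply: measurableT_comp => //; apply: measurable_fun_limn_esup => n.
    exact: measurableT_comp.
  apply/funext => t; rewrite -limn_einfN; congr limn_einf.
  by apply/funext => n; rewrite /comp oppeK.
- move=> t; rewrite limn_einf_lim; apply: lime_ge; first exact: is_cvg_einfs.
  by apply: nearW => n; apply: le_ereal_inf_tmp => _ [k _ <-].
- apply: ae_inS (ae_inI pre_ge0 pre_cvg) => t tT [p0 pc].
  have e : Phi^~ t = EFin \o (pre^~ t).
    by apply/funext => n; rewrite /Phi /= max_r.
  rewrite e; have [|-> //] := @cvg_limn_einf_sup R (EFin \o pre^~ t)
    (energy_density t)%:E.
  by apply: cvg_EFin => //; exact: nearW.
- apply: le_trans (fatou mu mD mPhi (fun n t _ => Phi0 n t)) _.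
  rewrite limn_einf_lim; apply: lime_le; first exact: is_cvg_einfs.
  apply: nearW => n; apply: (@le_trans _ _ (\int[mu]_(x in D) Phi n x)%E).
    by apply: ereal_inf_lbound; exists n => /=.
  apply: (@le_trans _ _ (\int[mu]_(t in D) (bound n t)%:E)%E); last first.
    by rewrite -(fineK (integrable_fin_num mD (ibound n))) lee_fin; exact: bound_le.
  have -> : (\int[mu]_(t in D) (bound n t)%:E =
             \int[mu]_(t in D) (Num.max 0 (bound n t))%:E)%E.
    apply: ae_eq_integral => //.
    + by case/integrableP: (ibound n).
    + apply/measurable_EFinP; apply: measurable_maxr; first exact: measurable_cst.
      by apply/measurable_EFinP; case/integrableP: (ibound n).
    + apply: ae_in_itvP; apply: ae_inS pre_ge0 => t tT h1.
      by rewrite max_r// (le_trans _ (pre_bound n t)).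
  apply: ge0_le_integral => //.
  + apply/measurable_EFinP; apply: measurable_maxr; first exact: measurable_cst.
    by apply/measurable_EFinP; case/integrableP: (ibound n).
  + move=> t _; rewrite lee_fin ge_max le_max lexx/=.
    by rewrite le_max pre_bound orbT.
Qed.

End energy.

(** * Orthonormal expansions *)

Section finite_dimensional.
Context {R : realType} {H : normedModType R} {ip : H -> H -> R}.
Hypothesis hip : inner_product ip.

(** Gram-Schmidt by induction on a list [s] of test vectors that separates the points of [S], rather
    than on a spanning family of [S]. A list that works for [Qt] thus applies unchanged to every
    subspace of [Qt]. *)
Lemma finite_expansion (S : set H) (s : seq H) :
  S 0 -> (forall a x y, S x -> S y -> S (a *: x + y)) ->
  (forall x, S x -> (forall w, w \in s -> ip x w = 0) -> x = 0) ->
  exists e : seq H, (forall w, w \in e -> S w) /\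
    forall x, S x -> x = \sum_(w <- e) ip x w *: w.
Proof.
elim: s S => [|v s IH] S S0 SD Ss.
  by exists [::]; split => // x Sx; rewrite big_nil; exact: Ss.
pose S' : set H := [set x | S x /\ ip x v = 0].
have [| |x [Sx xv] xs|e [eS' xe]] := IH S'.
- by split; rewrite ?(ip0l hip).
- move=> a x y [Sx xv] [Sy yv]; split; first exact: SD.
  by rewrite (ipDl hip) (ipZl hip) xv yv mulr0 addr0.
- by apply: Ss => // w; rewrite inE => /orP[/eqP ->//|]; exact: xs.
have [[x0 [Sx0 x0v]]|nex] := pselect (exists x0, S x0 /\ ip x0 v != 0); last first.
  exists e; split => [w /eS'[]//|x Sx]; apply: xe; split => //.
  by apply: contrapT => /eqP xv; apply: nex; exists x.
have S'D a x y : S' x -> S' y -> S' (a *: x + y).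
  move=> [Sx xv] [Sy yv]; split; first exact: SD.
  by rewrite (ipDl hip) (ipZl hip) xv yv mulr0 addr0.
(* [r] is the component of [x0] orthogonal to [S']; normalised, it is the new basis vector. *)
pose p0 := \sum_(w <- e) ip x0 w *: w; pose r := x0 - p0.
have S'p0 : S' p0.
  rewrite /p0; elim: (e) eS' => [_|w e' IHe eS']; first by rewrite big_nil; split; rewrite ?(ip0l hip).
  rewrite big_cons; apply: S'D; first exact: (eS' w (mem_head _ _)).
  by apply: IHe => w' w'e; apply: eS'; rewrite inE w'e orbT.
have orth x : S' x -> ip r x = 0.
  move=> S'x; rewrite /r /p0 (ipBl hip) {1}(xe x S'x) (ip_sumr hip) (ip_suml hip).
  apply/eqP; rewrite subr_eq0; apply/eqP; apply: eq_bigr => w _.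
  by rewrite (ipZl hip) (ipZr hip) (ipC hip w x) mulrC.
have r0 : `|r| != 0.
  rewrite normr_eq0; apply/eqP => r0; move/eqP: x0v; apply.
  by have -> : x0 = p0; [apply/eqP; rewrite -subr_eq0 -/r r0|case: S'p0].
have Sr : S r by rewrite /r addrC -scaleN1r; apply: SD => //; case: S'p0.
exists (`|r|^-1 *: r :: e); split.
  move=> w; rewrite inE => /orP[/eqP ->|/eS'[]//].
  by rewrite -[_ *: _]addr0; exact: SD.
(* [c] is chosen so that [y = x - c r] is orthogonal to [v], hence lies in [S']. *)
move=> x Sx; pose c := ip x v / ip x0 v; pose y := - c *: x0 + x + c *: p0.
have S'y : S' y.
  rewrite /y addrC; apply: S'D => //; split; first exact: SD.
  by rewrite (ipDl hip) (ipZl hip) /c; field.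
have xE : x = c *: r + y.
  by rewrite /y /r scalerBr scaleNr [_ + x + _]addrAC addrA addrACA subrr addNr !add0r.
clearbody y c; rewrite big_cons {1}xE; congr (_ + _).
  rewrite xE (ipDl hip) !(ipZr hip) (ipC hip y) (orth y S'y) (ipZl hip) (ipxx hip).
  by rewrite mulr0 addr0 scalerA; congr (_ *: _); field.
rewrite {1}(xe y S'y); rewrite [in LHS]big_seq [in RHS]big_seq; apply: eq_bigr => w we.
by rewrite xE (ipDl hip) (ipZl hip) (orth w (eS' w we)) mulr0 add0r.
Qed.

End finite_dimensional.

(** * Limits of simple functions *)

Section strong_measurability.
Context {R : realType}.

(** Convergence is required at every [t], exceptional null sets being removed beforehand, so that
    stability under continuous maps is a pointwise matter. *)
Definition simple_limit (V : normedModType R) (v : R -> V) : Prop :=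
  exists s : nat -> R -> V, (forall n, simple_fun setT (s n)) /\
    forall t, s n t @[n --> \oo] --> v t.

Lemma simple_fun_preimage (X : Type) (S : set X) (s : R -> X) (A : set X) :
  simple_fun S s -> measurable (s @^-1` A : set (measurableTypeR R)).
Proof.
move=> [fs _ ms].
have -> : s @^-1` A = \bigcup_(x in range s `&` A) (s @^-1` [set x]).
  apply/seteqP; split => [t At|t [x [_ Ax] /= ->//]].
  by exists (s t) => //; split => //; exists t.
by apply: fin_bigcup_measurable => [|x _]; [exact: finite_setIl|exact: ms].
Qed.

Lemma simple_fun2 (X Y Z : Type) (F : X -> Y -> Z) (s : R -> X) (s' : R -> Y) :
  simple_fun setT s -> simple_fun setT s' ->
  simple_fun setT (fun t => F (s t) (s' t)).
Proof.
move=> hs hs'; split => //.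
  have [fs _ _] := hs; have [fs' _ _] := hs'.
  apply: sub_finite_set (finite_image2 F fs fs') => _ [t _ <-].
  by exists (s t) => //; exists (s' t).
move=> z.
have -> : (fun t => F (s t) (s' t)) @^-1` [set z] = \bigcup_(x in range s)
    (s @^-1` [set x] `&` s' @^-1` [set y | F x y = z]).
  apply/seteqP; split => [t /= tz|t [x _ [/= -> //]]].
  by exists (s t).
have [fs _ ms] := hs; apply: fin_bigcup_measurable => // x _.
by apply: measurableI; [exact: ms|exact: simple_fun_preimage hs'].
Qed.

Lemma simple_limit2 (V W X : normedModType R) (F : V -> W -> X) v w :
  (forall (f : nat -> V) (g : nat -> W) a c, f @ \oo --> a -> g @ \oo --> c ->
    F (f n) (g n) @[n --> \oo] --> F a c) ->
  simple_limit v -> simple_limit w -> simple_limit (fun t => F (v t) (w t)).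
Proof.
move=> cF [s [ss sv]] [s' [ss' sw]]; exists (fun n t => F (s n t) (s' n t)).
by split => [n|t]; [exact: simple_fun2|exact: cF].
Qed.

Lemma simple_limit_cst (V : normedModType R) (c : V) : simple_limit (fun=> c).
Proof.
exists (fun _ _ => c); split => [n|t]; last exact: cvg_cst.
split => // [|x]; first by apply: sub_finite_set (finite_set1 c) => _ [t _ <-].
have [->|xc] := eqVneq x c.
  by rewrite (_ : _ @^-1` _ = setT)//; apply/seteqP; split.
rewrite (_ : _ @^-1` _ = set0)//; apply/seteqP; split => // t /= cx.
by rewrite cx eqxx in xc.
Qed.

Lemma simple_limit_comp (V W : normedModType R) (F : V -> W) v :
  continuous F -> simple_limit v -> simple_limit (fun t => F (v t)).
Proof.
move=> cF hv; apply: (simple_limit2 (F := fun a _ => F a) _ hv hv) => f g a c fa _.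
exact: (cvg_comp _ _ fa (cF a)).
Qed.

Lemma simple_limitD (V : normedModType R) (v w : R -> V) :
  simple_limit v -> simple_limit w -> simple_limit (fun t => v t + w t).
Proof. by apply: (simple_limit2 (F := +%R)) => *; exact: cvgD. Qed.

Lemma simple_limitB (V : normedModType R) (v w : R -> V) :
  simple_limit v -> simple_limit w -> simple_limit (fun t => v t - w t).
Proof.
by apply: (simple_limit2 (F := fun x y => x - y)) => *; exact: cvgB.
Qed.

Lemma simple_limit_norm (V : normedModType R) (v : R -> V) :
  simple_limit v -> simple_limit (fun t => `|v t|).
Proof.
move=> hv; apply: (simple_limit_comp (F := fun x : V => `|x|)) hv.
exact: norm_continuous.
Qed.

Lemma simple_limit_measurable (D : set (measurableTypeR R)) (f : R -> R) :
  measurable D -> simple_limit f -> measurable_fun D f.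
Proof.
move=> mD [s [ss sf]]; apply: (measurable_fun_cvg (h := s)) => // n _ Y _.
by apply: measurableI => //; exact: simple_fun_preimage (ss n).
Qed.

(** Both [v] and its approximants are set to 0 off a measurable set of good points; [S 0] keeps the
    values in [S]. *)
Lemma strongly_measurable_simple_limit (V : normedModType R) (S : set V) (T : R)
    (v : R -> V) :
  ae_in T (fun t => S (v t)) -> S 0 -> strongly_measurable S (fun x => `|x|) T v ->
  exists v' : R -> V,
    [/\ simple_limit v', forall t, S (v' t) & ae_in T (fun t => v t = v' t)].
Proof.
move=> Sv S0 [s [ss sv]].
have [Z [mZ muZ hZ]] := ae_inI Sv sv.
pose D : set (measurableTypeR R) := `]0, T[ `\` Z.
have mD : measurable D by apply: measurableD => //; exact: measurable_itv.
have good t : t \in D -> S (v t) /\ `|s n t - v t| @[n --> \oo] --> 0.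
  move=> /set_mem[tT nZ]; apply: contrapT => nh; apply: nZ; apply: hZ => /= h.
  by apply: nh; apply: h; move: tT; rewrite /= in_itv.
exists (fun t => if t \in D then v t else 0); split.
- exists (fun n t => if t \in D then s n t else 0); split.
  + move=> n; have sD : simple_fun setT (fun t : R => t \in D).
      split => // -[].
        rewrite (_ : _ @^-1` _ = D)//; apply/seteqP; split => t /=.
          by move/set_mem.
        by move/mem_set.
      rewrite (_ : _ @^-1` _ = ~` D); first exact: measurableC.
      apply/seteqP; split => t /=; first by move/negbT; rewrite notin_setE.
      by move=> tD; apply/negbTE; rewrite notin_setE.
    have sn : simple_fun setT (s n) by have [? _ ?] := ss n.
    exact: (simple_fun2 (fun (b : bool) x => if b then x else 0) sD sn).
  + move=> t; case: ifPn => [/good[_ h]|_]; last exact: cvg_cst.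
    by apply/subr_cvg0; apply/norm_cvg0P.
- by move=> t; case: ifPn => // /good[].
- exists Z; split => // t /= nh; apply: contrapT => nZ; apply: nh => tT.
  by rewrite mem_set//; split => //=; rewrite in_itv.
Qed.

End strong_measurability.

(** * Square integrable scalar functions *)

Section square_integrable.
Context {R : realType} (T : R).
Local Notation mu := (@lebesgue_measure R).
Let D : set (measurableTypeR R) := `]0, T[%classic.
Implicit Types (f h : R -> R).

Let mD : measurable D. Proof. exact: measurable_itv. Qed.

Lemma sqrte_le (x y : \bar R) : (0 <= y -> x <= y -> sqrte x <= sqrte y)%E.
Proof. by move=> y0 xy; rewrite lee_sqrt. Qed.

(** Rests on lower integrals, and so covers the error [e], whose norm is not shown to be
    measurable. *)
Lemma L2norm_ae_le (X Y : Type) (N : X -> R) (N' : Y -> R) v w :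
  ae_in T (fun t => 0 <= N (v t) <= N' (w t)) -> (L2norm T N v <= L2norm T N' w)%E.
Proof.
move=> vw; apply: sqrte_le.
  by apply: integral_ge0 => t _; rewrite lee_fin sqr_ge0.
apply: ge0_ae_le_lower_integral => [t _|t _|]; rewrite ?lee_fin ?sqr_ge0//.
apply: ae_in_itvP; apply: ae_inS vw => t _ /andP[v0 vw].
by rewrite lee_fin ler_sqr ?nnegrE// (le_trans v0 vw).
Qed.

Lemma L2norm_ae_eq (X Y : Type) (N : X -> R) (N' : Y -> R) v w :
  ae_in T (fun t => N (v t) = N' (w t)) -> L2norm T N v = L2norm T N' w.
Proof.
move=> vw; congr sqrte.
apply: ge0_ae_eq_lower_integral => [t _|t _|]; rewrite ?lee_fin ?sqr_ge0//.
by apply: ae_in_itvP; apply: ae_inS vw => t _ ->.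
Qed.

Lemma L2norm_Lnorm f : L2norm T id f = ('N[mu]_2%:E[EFin \o f \_ D])%E.
Proof.
rewrite unlock /Lnorm poweR12_sqrt; last first.
  by apply: integral_ge0 => t _; exact: poweR_ge0.
congr sqrte; rewrite [LHS]integral_mkcond; apply: eq_integral => t _.
rewrite /= /patch; case: ifPn => _ /=.
  by rewrite powR_mulrn// real_normK ?num_real.
by rewrite normr0 powR0.
Qed.

Lemma L2norm_add f h : measurable_fun D f -> measurable_fun D h ->
  (L2norm T id (fun t => f t + h t)%R <= L2norm T id f + L2norm T id h)%E.
Proof.
move=> mf mh; rewrite !L2norm_Lnorm.
have mr (k : measurableTypeR R -> R) : measurable_fun D k ->
      measurable_fun [set: measurableTypeR R] (k \_ D).
  by move=> mk; exact: (measurable_restrictT k mD).1.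
have -> : (fun t => f t + h t)%R \_ D = (f \_ D \+ h \_ D)%R.
  by apply/funext => t; rewrite /= /patch; case: ifPn => //; rewrite addr0.
by apply: minkowski_EFin; [exact: mr|exact: mr|rewrite ler1n].
Qed.

Lemma L2norm_scale f (c : R) : 0 <= c -> measurable_fun D f ->
  L2norm T id (fun t => c * f t)%R = (c%:E * L2norm T id f)%E.
Proof.
move=> c0 mf; rewrite /L2norm.
have -> : (\int[mu]_(t in D) ((c * f t) ^+ 2)%R%:E =
    (c ^+ 2)%R%:E * \int[mu]_(t in D) ((f t) ^+ 2)%R%:E)%E.
  under eq_integral do rewrite exprMn EFinM.
  rewrite ge0_integralZl ?lee_fin ?sqr_ge0//.
    by apply/measurable_EFinP; apply: measurable_funX.
  by move=> t _; rewrite lee_fin sqr_ge0.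
by rewrite (@sqrteM R) ?lee_fin ?sqr_ge0//= sqrtr_sqr ger0_norm.
Qed.

Definition square_integrable f :=
  measurable_fun D f /\ mu.-integrable D (EFin \o (fun t => f t ^+ 2)).

Lemma le_integrable_ge0 f h : measurable_fun D f -> mu.-integrable D (EFin \o h) ->
  (forall t, 0 <= f t <= h t) -> mu.-integrable D (EFin \o f).
Proof.
move=> mf ih fh; apply: (le_integrable mD _ _ ih); first exact/measurable_EFinP.
move=> t _; have /andP[f0 le_fh] := fh t; rewrite lee_fin.
by rewrite !ger0_norm// (le_trans f0 le_fh).
Qed.

Lemma square_integrable_cst (c : R) : square_integrable (fun=> c).
Proof.
split; first exact: measurable_cst.
by apply: (@integrable_itvoo_continuous _ (fun=> _)) => t; exact: cvg_cst.
Qed.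

Lemma square_integrable_le f h : measurable_fun D f -> square_integrable h ->
  (forall t, `|f t| <= `|h t|) -> square_integrable f.
Proof.
move=> mf [mh ih] fh; split=> //; apply: le_integrable_ge0 ih _.
  exact: measurable_funX.
move=> t; rewrite sqr_ge0 -(real_normK (num_real (f t))).
by rewrite -(real_normK (num_real (h t))) ler_sqr ?nnegrE ?fh.
Qed.

Lemma square_integrableD f h : square_integrable f -> square_integrable h ->
  square_integrable (fun t => f t + h t).
Proof.
move=> [mf If] [mh ih]; split; first exact: measurable_funD.
apply: (@le_integrable_ge0 _ (fun t => 2 * f t ^+ 2 + 2 * h t ^+ 2)).
- by apply: measurable_funX; exact: measurable_funD.
- have := integrableD mD (integrableZl mD 2 If) (integrableZl mD 2 ih).
  by apply: eq_integrable.
- by move=> t; rewrite sqr_ge0/=; have := sqr_ge0 (f t - h t); lra.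
Qed.

Lemma square_integrableZ f (c : R) : square_integrable f ->
  square_integrable (fun t => c * f t).
Proof.
move=> [mf If]; split; first exact: measurable_funM.
have := integrableZl mD (c ^+ 2) If.
by apply: eq_integrable => // t _; rewrite /= exprMn.
Qed.

Lemma square_integrable_integrable f : square_integrable f ->
  mu.-integrable D (EFin \o f).
Proof.
move=> sf; have [mf If] := sf.
have [_ i1] := square_integrable_cst 1.
apply: (@le_integrable _ _ _ mu D mD _ (EFin \o (fun t => 1 + f t ^+ 2))).
- exact/measurable_EFinP.
- move=> t _; rewrite lee_fin [leRHS]ger0_norm ?addr_ge0 ?sqr_ge0//.
  rewrite ler_norml; have := sqr_ge0 (f t - 1); have := sqr_ge0 (f t + 1).
  by move=> ? ?; apply/andP; split; lra.
- have := integrableD mD i1 If; apply: eq_integrable => // t _.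
  by rewrite /= expr1n.
Qed.

Lemma L2norm_square_integrable f : square_integrable f ->
  L2norm T id f = (Num.sqrt (\int[mu]_(t in D) (f t ^+ 2)))%:E.
Proof.
move=> [mf If]; rewrite /L2norm -(fineK (integrable_fin_num mD If)).
by rewrite /Rintegral.
Qed.

(** Supplies a representative with values in [S] at every [t], so that the properties of [B] and [E]
    on [Qt] hold along it without exceptional times. *)
Lemma L2_simple_limit (V : normedModType R) (S : set V) (v : R -> V) :
  S 0 -> L2 S (fun x => `|x|) T v ->
  exists v' : R -> V, [/\ simple_limit v', forall t, S (v' t),
    ae_in T (fun t => v t = v' t) & square_integrable (fun t => `|v' t|)].
Proof.
move=> S0 [Sv sv nv].
have [v' [sv' Sv' vv']] := strongly_measurable_simple_limit Sv S0 sv.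
have mv' : measurable_fun D (fun t => `|v' t|).
  by apply: simple_limit_measurable => //; exact: simple_limit_norm.
exists v'; split => //; split => //; apply/integrableP; split.
  by apply/measurable_EFinP; exact: measurable_funX.
have -> : (\int[mu]_(t in D) `|(EFin \o (fun t => (`|v' t| ^+ 2)%R)) t| =
    \int[mu]_(t in D) (`|v t| ^+ 2)%R%:E)%E.
  apply: ge0_ae_eq_lower_integral => [t _|t _|]; rewrite ?lee_fin ?sqr_ge0//.
  apply: ae_in_itvP; apply: ae_inS vv' => t _ ->.
  by rewrite /= ger0_norm// sqr_ge0.
move: nv; rewrite /L2norm /D; case: integral => // r _; exact: ltry.
Qed.

End square_integrable.

Lemma lipschitz_continuous (R : realType) (W : normedModType R) (F : W -> R) (K : R) :
  (forall x y, `|F x - F y| <= K * `|x - y|) -> continuous F.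
Proof.
move=> FK x; apply/subr_cvg0.
have lim0 : K * `|y - x| @[y --> x] --> (0 : R).
  have -> : 0 = K * `|x - x| by rewrite subrr normr0 mulr0.
  apply: cvgM; first exact: cvg_cst.
  by apply: cvg_norm; apply: cvgB; [exact: cvg_id|exact: cvg_cst].
apply: (@squeeze_cvgr _ _ _ _ (fun y => - (K * `|y - x|))
  (fun y => K * `|y - x|)) => //.
  by apply: nearW => y; rewrite -ler_norml.
by rewrite -[X in _ --> X]oppr0; exact: cvgN.
Qed.

(** * A norm on a subspace along finite expansions *)

Section norm_on_subspace.
Context {R : realType} {H : normedModType R} {ip : H -> H -> R}.
Hypothesis hip : inner_product ip.
Variables (V : set H) (N : H -> R).
Hypothesis V0 : V 0.
Hypothesis VD : forall a x y, V x -> V y -> V (a *: x + y).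
Hypothesis hN : norm_on V N.

Lemma subspaceZ a x : V x -> V (a *: x).
Proof. by move=> Vx; rewrite -[_ *: _]addr0; exact: VD. Qed.

Lemma subspace_sum (I : eqType) (e : seq I) (a : I -> R) (z : I -> H) :
  (forall w, w \in e -> V (z w)) -> V (\sum_(w <- e) a w *: z w).
Proof.
elim: e => [|w e IH] Vz; first by rewrite big_nil.
rewrite big_cons; apply: VD; first exact: Vz (mem_head _ _).
by apply: IH => w' w'e; apply: Vz; rewrite inE w'e orbT.
Qed.

Lemma norm_on0 : N 0 = 0.
Proof. by have [_ _ h _] := hN; have := h 0 0 V0; rewrite scale0r normr0 mul0r. Qed.

Lemma norm_onN x : V x -> N (- x) = N x.
Proof.
by have [_ _ h _] := hN; move=> /(h (-1)); rewrite scaleN1r normrN1 mul1r.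
Qed.

Lemma norm_on_sub x y : V x -> V y -> N (x - y) <= N x + N y.
Proof.
move=> Vx Vy; have [_ _ _ h] := hN; rewrite -(norm_onN Vy); apply: h => //.
by rewrite -scaleN1r; exact: subspaceZ.
Qed.

Lemma norm_on_dist x y : V x -> V y -> `|N x - N y| <= N (x - y).
Proof.
have le a c : V a -> V c -> N a - N c <= N (a - c).
  move=> Va Vc; have [_ _ _ h] := hN; rewrite lerBlDr -{1}(subrK c a); apply: h => //.
  by rewrite addrC -scaleN1r; exact: VD.
move=> Vx Vy; rewrite ler_norml le// andbT lerNl opprB.
rewrite (le_trans (le _ _ Vy Vx))// -opprB norm_onN//.
by rewrite addrC -scaleN1r; exact: VD.
Qed.

Lemma norm_on_sum (I : eqType) (e : seq I) (a : I -> R) (z : I -> H) :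
  (forall w, w \in e -> V (z w)) ->
  N (\sum_(w <- e) a w *: z w) <= \sum_(w <- e) `|a w| * N (z w).
Proof.
elim: e => [|w e IH] Vz; first by rewrite !big_nil norm_on0.
have Vw : V (z w) by exact: Vz (mem_head _ _).
have Vz' w' : w' \in e -> V (z w') by move=> w'e; apply: Vz; rewrite inE w'e orbT.
have [_ _ hZ hD] := hN.
rewrite !big_cons (le_trans (hD _ _ _ _))//; [exact: subspaceZ|exact: subspace_sum|].
by rewrite hZ// lerD2l IH.
Qed.

Lemma norm_on_expansion_le (e : seq H) (z : H -> H) x :
  (forall w, w \in e -> V (z w)) ->
  N (\sum_(w <- e) ip x w *: z w) <= (\sum_(w <- e) `|w| * N (z w)) * `|x|.
Proof.
move=> Vz; apply: le_trans (norm_on_sum _ Vz) _.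
rewrite mulr_suml big_seq [leRHS]big_seq; apply: ler_sum => w we.
have [h0 _ _ _] := hN.
rewrite mulrAC; apply: ler_wpM2r; first by apply: h0; exact: Vz.
by rewrite mulrC; exact: (ip_norm hip).
Qed.

(** The finite dimensional comparison of [N] with the norm of [H]. With [c] and [z] read off from an
    expansion, it gives measurability and square integrability of [N] along functions with values in
    [Qt]. *)
Lemma norm_on_expansion_lipschitz (e : seq H) (c : H) (z : H -> H) :
  V c -> (forall w, w \in e -> V (z w)) ->
  let F x := N (c + \sum_(w <- e) ip x w *: z w) in
  exists K, forall x y, `|F x - F y| <= K * `|x - y|.
Proof.
move=> Vc Vz F; exists (\sum_(w <- e) `|w| * N (z w)) => x y.
have VF x' : V (c + \sum_(w <- e) ip x' w *: z w).
  by rewrite -[c]scale1r; apply: VD => //; exact: subspace_sum.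
apply: le_trans (norm_on_dist (VF x) (VF y)) _.
rewrite opprD addrACA subrr add0r -sumrB.
under eq_bigr do rewrite -scalerBl -(ipBl hip).
exact: norm_on_expansion_le.
Qed.

End norm_on_subspace.

(** * The energy norm and the continuity constant *)

Section energy_norm.
Context {R : realType} {Q : normedModType R} {b : Q -> Q -> R} {N : Q -> R}.
Hypothesis b_bounded : bounded_form b.
Hypothesis b_coercive : coercive_form b.
Hypothesis N_ge0 : forall q, 0 <= N q.
Hypothesis N_energy : forall q, N q ^+ 2 = b q q.

Lemma energy_norm_ge : exists2 a, 0 < a & forall q, a * `|q| <= N q.
Proof.
have [a a0 ha] := b_coercive; exists (Num.sqrt a); first by rewrite sqrtr_gt0.
move=> q; rewrite -ler_sqr ?nnegrE ?mulr_ge0 ?sqrtr_ge0// exprMn.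
by rewrite sqr_sqrtr ?(ltW a0)// N_energy.
Qed.

Lemma energy_norm_eq0 q : N q = 0 -> q = 0.
Proof.
move=> Nq; have [a a0 /(_ q)] := energy_norm_ge.
by rewrite Nq pmulr_rle0// normr_le0 => /eqP.
Qed.

Lemma bounded_formP : exists2 M, 0 <= M & forall q q', `|b q q'| <= M * `|q| * `|q'|.
Proof.
have [M hM] := b_bounded; exists `|M| => // q q'; rewrite (le_trans (hM q q'))//.
by rewrite -!mulrA ler_wpM2r ?mulr_ge0// ler_norm.
Qed.

Lemma energy_norm_le : exists2 M, 0 <= M & forall q, N q <= M * `|q|.
Proof.
have [M M0 hM] := bounded_formP; exists (Num.sqrt M); first exact: sqrtr_ge0.
move=> q; rewrite -ler_sqr ?nnegrE ?mulr_ge0 ?sqrtr_ge0// exprMn.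
rewrite sqr_sqrtr// N_energy (le_trans (ler_norm _))// (le_trans (hM q q))//.
by rewrite -mulrA -expr2.
Qed.

Let consts := [set c : R | 0 <= c /\ forall q q', `|b q q'| <= c * N q * N q'].

Let consts_inf : has_inf consts.
Proof.
split; last by exists 0 => c [].
have [M M0 hM] := bounded_formP; have [a a0 ha] := energy_norm_ge.
exists (M / a ^+ 2); split; first by rewrite divr_ge0// sqr_ge0.
move=> q q'; rewrite (le_trans (hM q q'))//.
have -> : M * `|q| * `|q'| = M / a ^+ 2 * (a * `|q|) * (a * `|q'|).
  by field; rewrite gt_eqF.
rewrite -[leLHS]mulrA -[leRHS]mulrA ler_wpM2l ?divr_ge0 ?sqr_ge0//.
by rewrite ler_pM ?mulr_ge0 ?(ltW a0).
Qed.

Lemma continuity_constant_ge0 : 0 <= continuity_constant N b.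
Proof. by apply: lb_le_inf => [|c []//]; case: consts_inf. Qed.

(** The infimum is itself admissible: divide by [N q * N q'] if positive; if this product is 0, any
    admissible constant already forces [b q q' = 0]. *)
Lemma continuity_constantP q q' : `|b q q'| <= continuity_constant N b * N q * N q'.
Proof.
have [q0|q0] := eqVneq (N q * N q') 0.
  have [c [_ hc]] := consts_inf.1.
  by rewrite -mulrA q0 mulr0; have := hc q q'; rewrite -mulrA q0 mulr0.
have qq : 0 < N q * N q' by rewrite lt_neqAle eq_sym q0 mulr_ge0.
rewrite -mulrA -ler_pdivrMr//; apply: lb_le_inf; first by case: consts_inf.
by move=> c [_ hc]; rewrite ler_pdivrMr// mulrA.
Qed.

End energy_norm.

(** * The dual norm *)

Section dual_norm.
Context {R : realType} {Q H : normedModType R} {ip : H -> H -> R}.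
Hypothesis hip : inner_product ip.
Variables (iota : Q -> H) (N : H -> R) (C : R).
Hypothesis N_gt0 : forall q, q != 0 -> 0 < N (iota q).
Hypothesis iota_le : forall q, `|iota q| <= C * N (iota q).

Let ratio x q : q != 0 -> ip x (iota q) / N (iota q) <= C * `|x|.
Proof.
move=> q0; rewrite ler_pdivrMr ?N_gt0// (le_trans (ler_norm _))//.
by rewrite (le_trans (ip_norm hip _ _))// mulrC mulrAC ler_wpM2r.
Qed.

Lemma dual_normP x q : q != 0 -> ip x (iota q) <= dual_norm ip iota N x * N (iota q).
Proof.
move=> q0; rewrite -ler_pdivrMr ?N_gt0//; apply: ub_le_sup; last by exists q.
by exists (C * `|x|) => _ [q' q'0 <-]; exact: ratio.
Qed.

Lemma dual_norm_lipschitz x y :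
  `|dual_norm ip iota N x - dual_norm ip iota N y| <= `|C| * `|x - y|.
Proof.
have le a c : [set q : Q | q != 0] !=set0 ->
    dual_norm ip iota N a - dual_norm ip iota N c <= C * `|a - c|.
  move=> [q0 hq0]; rewrite lerBlDr; apply: ge_sup => [|_ [q q1 <-]].
    by exists (ip a (iota q0) / N (iota q0)); exists q0.
  rewrite -{1}(subrK c a) (ipDl hip) mulrDl lerD//; first exact: ratio.
  by rewrite ler_pdivrMr ?N_gt0//; exact: dual_normP.
have [ne|ne] := pselect ([set q : Q | q != 0] !=set0).
  rewrite (@le_trans _ _ (C * `|x - y|)) ?ler_wpM2r ?ler_norm//.
  by rewrite ler_norml le// andbT lerNl opprB distrC le.
(* If [Q] has no nonzero element, the supremum is over the empty set and takes the default value
   0. *)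
have dn0 z : dual_norm ip iota N z = 0.
  rewrite /dual_norm (_ : [set _ | q in _] = set0) ?sup0//.
  by apply/seteqP; split => // r [q q0 _]; apply: ne; exists q.
by rewrite !dn0 subrr normr0 mulr_ge0.
Qed.

End dual_norm.

(** * Continuous representatives on [[0, T]] *)

Section continuous_representatives.
Context {R : realType}.
Local Notation mu := (@lebesgue_measure R).

Lemma weak_derivative_ae (T : R) (u v du dv : R -> R) :
  ae_in T (fun t => u t = v t) -> ae_in T (fun t => du t = dv t) ->
  weak_derivative T u du -> weak_derivative T v dv.
Proof.
move=> uv duv udu phi hphi; have := udu phi hphi.
have -> : \int[mu]_(t in `]0, T[) (u t * derive1 phi t) =
    \int[mu]_(t in `]0, T[) (v t * derive1 phi t).
  by apply: ae_eq_Rintegral; apply: ae_in_itvP; apply: ae_inS uv => t _ ->.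
have -> : \int[mu]_(t in `]0, T[) (du t * phi t) =
    \int[mu]_(t in `]0, T[) (dv t * phi t).
  by apply: ae_eq_Rintegral; apply: ae_in_itvP; apply: ae_inS duv => t _ ->.
by [].
Qed.

Lemma primitive_cst (f : R -> R) (s t : R) : mu.-integrable setT (EFin \o f) ->
  s <= t -> (forall x, s < x <= t -> f x = 0) -> primitive f t = primitive f s.
Proof.
move=> If st f0; apply/eqP; rewrite -subr_eq0 primitiveB//.
have -> : \int[mu]_(x in `]s, t]) f x = \int[mu]_(x in `]s, t]) (cst 0) x.
  by apply: eq_Rintegral => x; rewrite mem_setE in_itv/= => /f0.
by rewrite /Rintegral integral0.
Qed.

Lemma primitiveD (f g : R -> R) (t : R) : mu.-integrable setT (EFin \o f) ->
  mu.-integrable setT (EFin \o g) ->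
  primitive (fun x => f x + g x) t = primitive f t + primitive g t.
Proof.
by move=> If Ig; apply: RintegralD; try (apply: integrableW => //);
  exact: measurable_itv.
Qed.

Lemma primitive_sub (f g : R -> R) (t : R) : mu.-integrable setT (EFin \o f) ->
  mu.-integrable setT (EFin \o g) ->
  primitive (fun x => f x - g x) t = primitive f t - primitive g t.
Proof.
by move=> If Ig; apply: RintegralB; try (apply: integrableW => //);
  exact: measurable_itv.
Qed.

Lemma integrable_restrictT (D : set (measurableTypeR R)) (f : R -> R) :
  measurable D -> mu.-integrable D (EFin \o f) ->
  mu.-integrable setT (EFin \o f \_ D).
Proof.
by move=> mD If; rewrite -restrict_EFin; exact/(integrable_mkcond _ mD).
Qed.

(** Balls have positive measure, so [h] cannot differ from [c] inside; the end points follow by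
    one-sided limits. *)
Lemma continuous_ae_cst (h : R -> R) (T c : R) : 0 < T -> continuous h ->
  ae_in T (fun t => h t = c) -> forall t, 0 <= t <= T -> h t = c.
Proof.
move=> T0 ch [Z [mZ muZ hZ]].
have oo t : 0 < t < T -> h t = c.
  move=> /andP[t0 tT]; apply: contrapT => /eqP htc.
  have nc : nbhs (h t) [set x | x != c].
    by apply: open_nbhs_nbhs; split; [exact: open_neq|exact: htc].
  have /nbhs_ballP[e /= e0 he] := ch t _ nc.
  pose r := Num.min e (Num.min t (T - t)).
  have r0 : 0 < r by rewrite !lt_min e0 t0 subr_gt0.
  have : mu (ball t r) = 0.
    apply: (@subset_measure0 _ _ _ mu _ Z) => //; first exact: measurable_ball.
    move=> x; rewrite /ball/= !lt_min => /andP[xe /andP[x1 x2]].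
    apply: hZ => /= hx; have /eqP := he x xe; apply; apply: hx.
    by move: x1 x2; rewrite !ltr_norml => /andP[? ?] /andP[? ?]; apply/andP; split; lra.
  rewrite lebesgue_measure_ball ?(ltW r0)// => -[] /eqP.
  by rewrite mulrn_eq0/= gt_eqF.
move=> t /andP[]; rewrite le_eqVlt => /predU1P[<-|t0].
  move=> _; have h0 : h x @[x --> 0^'+] --> h 0 by exact/cvg_at_right_filter/ch.
  have hc : h x @[x --> (0:R)^'+] --> c.
    apply: cvg_near_cst; near=> x; apply: oo; apply/andP; split; near: x.
      exact: nbhs_right_gt.
    exact: nbhs_right_lt.
  exact: cvg_unique h0 hc.
rewrite le_eqVlt => /predU1P[->|tT]; last by apply: oo; rewrite t0.
have h0 : h x @[x --> T^'-] --> h T by exact/cvg_at_left_filter/ch.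
have hc : h x @[x --> T^'-] --> c.
  apply: cvg_near_cst; near=> x; apply: oo; apply/andP; split; near: x.
    exact: nbhs_left_gt.
  exact: nbhs_left_lt.
exact: cvg_unique h0 hc.
Unshelve. all: by end_near. Qed.

(** The nearest-point map onto [[0, T]]. Composition with it extends a function continuous on
    [[0, T]] to the line, constant on either side, as backward differences near 0 require. *)
Definition clip (T t : R) : R := Num.max 0 (Num.min t T).

Lemma clip_in (T t : R) : 0 < T -> 0 <= clip T t <= T.
Proof.
by move=> T0; rewrite /clip le_max lexx/= ge_max (ltW T0) ge_min lexx orbT.
Qed.

Lemma clip_id (T t : R) : 0 <= t <= T -> clip T t = t.
Proof. by move=> /andP[t0 tT]; rewrite /clip min_l// max_r. Qed.

Lemma clip_le0 (T t : R) : 0 < T -> t <= 0 -> clip T t = 0.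
Proof.
by move=> T0 t0; rewrite /clip min_l ?max_l// (le_trans t0 (ltW T0)).
Qed.

Lemma clip_ge (T t : R) : 0 < T -> T <= t -> clip T t = T.
Proof. by move=> T0 tT; rewrite /clip min_r ?max_r// ltW. Qed.

Lemma clip_dist (T x y : R) : `|clip T x - clip T y| <= `|x - y|.
Proof.
have /andP[] : - `|x - y| <= x - y <= `|x - y| by rewrite -ler_norml.
rewrite /clip ler_norml.
case: (leP x T) => xT; case: (leP y T) => yT; rewrite /Num.max => ? ?;
  case: ifPn; rewrite -?leNgt => ?; try (case: ifPn; rewrite -?leNgt => ?);
  by apply/andP; split; lra.
Qed.

Lemma clip_continuous (T : R) : continuous (clip T).
Proof.
apply: (@lipschitz_continuous R R (clip T) 1) => x y; rewrite mul1r.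
exact: clip_dist.
Qed.

Lemma within_continuous_clip (H : normedModType R) (T : R) (w : R -> H) :
  0 < T -> {within `[0, T], continuous w} -> continuous (fun t => w (clip T t)).
Proof.
move=> T0 /subspace_continuousP cw t.
have ct : clip T x @[x --> t] --> within `[0, T] (nbhs (clip T t)).
  move=> A hA.
  have hc : \forall x \near t, `[0, T]%classic (clip T x) -> A (clip T x).
    exact: (@clip_continuous T t _ hA).
  suff : \forall x \near t, A (clip T x) by [].
  by apply: filterS hc => x; apply; rewrite /= in_itv; exact: clip_in.
apply: (cvg_comp _ _ ct); apply: cw.
rewrite /= in_itv; exact: clip_in.
Qed.

End continuous_representatives.

(** * From the energy inequality to a norm bound *)

Section energy_estimate.
Context {R : realType} (T : R).
Local Notation mu := (@lebesgue_measure R).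
Let D : set (measurableTypeR R) := `]0, T[%classic.

(* Young's inequality absorbs [kap y] into [kap^2 / 2 + y^2 / 2]. *)
Lemma energy_estimate (gam un y kap gu : R -> R) (W : R) (L : R -> \bar R) :
  square_integrable T gam -> square_integrable T un ->
  square_integrable T y -> square_integrable T kap -> 0 <= W ->
  measurable_fun D L -> (forall t, 0 <= L t)%E ->
  ae_in T (fun t => L t = (2^-1 * gam t ^+ 2 + 2^-1 * un t ^+ 2 - gu t)%:E) ->
  (\int[mu]_(t in D) L t <= (2^-1 * \int[mu]_(t in D) (gam t ^+ 2)%R +
     2^-1 * \int[mu]_(t in D) (un t ^+ 2)%R + 2^-1 * W ^+ 2)%R%:E)%E ->
  ae_in T (fun t => gu t <= - y t ^+ 2 + kap t * y t) ->
  (L2norm T id y <= W%:E + L2norm T id kap)%E.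
Proof.
move=> sgam sun sy skap W0 mL L0 LE intL hgu.
have mD : measurable D by exact: measurable_itv.
have [_ igam] := sgam; have [_ iun] := sun; have [_ iy] := sy; have [_ ikap] := skap.
have half f : mu.-integrable D (EFin \o f) ->
    mu.-integrable D (EFin \o (fun t => 2^-1 * f t)).
  by move=> If; have := integrableZl mD 2^-1 If; apply: eq_integrable.
have i2 : mu.-integrable D (EFin \o (fun t => 2^-1 * gam t ^+ 2 + 2^-1 * un t ^+ 2)).
  by have := integrableD mD (half _ igam) (half _ iun); apply: eq_integrable.
have i3 : mu.-integrable D
    (EFin \o (fun t => 2^-1 * gam t ^+ 2 + 2^-1 * un t ^+ 2 + 2^-1 * y t ^+ 2)).
  by have := integrableD mD i2 (half _ iy); apply: eq_integrable.
have : (\int[mu]_(t in D)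
    (2^-1 * gam t ^+ 2 + 2^-1 * un t ^+ 2 + 2^-1 * y t ^+ 2)%R%:E <=
    \int[mu]_(t in D) (L t + (2^-1 * kap t ^+ 2)%R%:E))%E.
  apply: ge0_ae_le_lower_integral => [t _|t _|].
  - by rewrite lee_fin !addr_ge0// mulr_ge0// sqr_ge0.
  - by rewrite adde_ge0// lee_fin mulr_ge0// sqr_ge0.
  apply: ae_in_itvP; apply: ae_inS (ae_inI LE hgu) => t _ [-> hg].
  by rewrite -EFinD lee_fin; have := sqr_ge0 (kap t - y t); lra.
rewrite ge0_integralD//; first last.
- by case/integrableP: (half _ ikap).
- by move=> t _; rewrite lee_fin mulr_ge0// sqr_ge0.
move=> h; have {}h := le_trans h (leeD intL (lexx _)).
move: h; rewrite -(fineK (integrable_fin_num mD i3)).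
rewrite -(fineK (integrable_fin_num mD (half _ ikap))) -EFinD lee_fin.
rewrite -!/(Rintegral _ _ _) RintegralD ?RintegralD ?RintegralZl//; try exact: half.
move=> h; rewrite !L2norm_square_integrable// -EFinD lee_fin.
have K0 : 0 <= \int[mu]_(t in D) kap t ^+ 2.
  by apply: Rintegral_ge0 => t _; exact: sqr_ge0.
have Y0 : 0 <= \int[mu]_(t in D) y t ^+ 2.
  by apply: Rintegral_ge0 => t _; exact: sqr_ge0.
(* [Y <= W^2 + K] implies [sqrt Y <= W + sqrt K], the cross term of the square being nonnegative. *)
rewrite -ler_sqr ?nnegrE ?addr_ge0 ?sqrtr_ge0// sqrrD !sqr_sqrtr//.
have : 0 <= W * Num.sqrt (\int[mu]_(t in D) kap t ^+ 2).
  by rewrite mulr_ge0// sqrtr_ge0.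
(* The correction built from [gam] and [un] has a finite integral and drops out here. *)
have cancel (a c k Y : R) : 2^-1 * a + 2^-1 * c + 2^-1 * Y <=
    2^-1 * a + 2^-1 * c + 2^-1 * W ^+ 2 + 2^-1 * k -> Y <= W ^+ 2 + k by lra.
move=> WK; apply: le_trans (cancel _ _ _ _ h) _.
by rewrite lerD2r lerDl mulrn_wge0.
Qed.

End energy_estimate.

(** * Square integrable functions with values in a normed space *)

Section square_integrable_vector.
Context {R : realType} (T : R).
Local Notation mu := (@lebesgue_measure R).
Let D : set (measurableTypeR R) := `]0, T[%classic.

Let mD : measurable D. Proof. exact: measurable_itv. Qed.

Definition square_integrable_vector (V : normedModType R) (v : R -> V) : Prop :=
  simple_limit v /\ square_integrable T (fun t => `|v t|).

Lemma square_integrable_vector_le (V W : normedModType R) (v : R -> V) (f : R -> R) :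
  simple_limit v -> square_integrable T f -> (forall t, `|v t| <= f t) ->
  square_integrable_vector v.
Proof.
move=> sv sf vf; split => //; apply: (square_integrable_le _ sf).
  by apply: simple_limit_measurable => //; exact: simple_limit_norm.
by move=> t; rewrite normr_id (le_trans (vf t))// ler_norm.
Qed.

Lemma square_integrable_vector_scalar (f : R -> R) :
  square_integrable_vector f -> square_integrable T f.
Proof.
move=> [sf nf]; apply: (square_integrable_le _ nf).
  exact: simple_limit_measurable.
by move=> t; rewrite normr_id.
Qed.

Lemma square_integrable_vector_cst (V : normedModType R) (c : V) :
  square_integrable_vector (fun=> c).
Proof. by split; [exact: simple_limit_cst|exact: square_integrable_cst]. Qed.

Lemma square_integrable_vectorD (V : normedModType R) (v w : R -> V) :
  square_integrable_vector v -> square_integrable_vector w ->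
  square_integrable_vector (fun t => v t + w t).
Proof.
move=> [sv nv] [sw nw]; apply: (square_integrable_vector_le V).
- exact: simple_limitD.
- exact: square_integrableD nv nw.
- by move=> t; exact: ler_normD.
Qed.

Lemma square_integrable_vectorB (V : normedModType R) (v w : R -> V) :
  square_integrable_vector v -> square_integrable_vector w ->
  square_integrable_vector (fun t => v t - w t).
Proof.
move=> [sv nv] [sw nw]; apply: (square_integrable_vector_le V).
- exact: simple_limitB.
- exact: square_integrableD nv nw.
- by move=> t; exact: ler_normB.
Qed.

Lemma square_integrable_lipschitz (V : normedModType R) (v : R -> V) (F : V -> R)
    (K : R) : (forall x y, `|F x - F y| <= K * `|x - y|) ->
  square_integrable_vector v -> square_integrable T (fun t => F (v t)).
Proof.
move=> FK [sv nv]; apply: square_integrable_vector_scalar.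
apply: (@square_integrable_vector_le _ R _ (fun t => `|F 0| + K * `|v t|)).
- exact: (simple_limit_comp (lipschitz_continuous FK) sv).
- by apply: square_integrableD;
    [exact: square_integrable_cst|exact: square_integrableZ].
- move=> t; rewrite -[F (v t)](subrK (F 0)) (le_trans (ler_normD _ _))//.
  by rewrite addrC lerD2l (le_trans (FK _ _))// subr0.
Qed.

End square_integrable_vector.

(** * Time-dependent finite expansions *)

Section expansions.
Context {R : realType} {H : normedModType R} {ip : H -> H -> R} (T : R).
Hypothesis hip : inner_product ip.
Local Notation mu := (@lebesgue_measure R).
Let D : set (measurableTypeR R) := `]0, T[%classic.

Let mD : measurable D. Proof. exact: measurable_itv. Qed.

Lemma square_integrable_ip (v : R -> H) (w : H) :
  square_integrable_vector T v -> square_integrable T (fun t => ip (v t) w).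
Proof.
apply: (@square_integrable_lipschitz _ _ _ _ (ip^~ w) `|w|) => x y.
by rewrite -(ipBl hip) mulrC; exact: (ip_norm hip).
Qed.

Lemma norm_expansion_le (W : normedModType R) (e : seq H) (y : H -> W) x :
  `|\sum_(w <- e) ip x w *: y w| <= (\sum_(w <- e) `|w| * `|y w|) * `|x|.
Proof.
rewrite (le_trans (ler_norm_sum _ _ _))// mulr_suml; apply: ler_sum => w _.
by rewrite normrZ mulrAC ler_wpM2r// mulrC; exact: (ip_norm hip).
Qed.

Lemma expansion_continuous (W : normedModType R) (e : seq H) (y : H -> W) :
  continuous (fun x => \sum_(w <- e) ip x w *: y w).
Proof.
move=> x; elim: e => [|w e IH].
  by under eq_fun do rewrite big_nil; exact: cvg_cst.
under eq_fun do rewrite big_cons; apply: cvgD => //.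
by apply: cvgZ; [apply: (ip_cvg hip); [exact: cvg_id|]|]; exact: cvg_cst.
Qed.

Lemma square_integrable_expansion (W : normedModType R) (e : seq H) (y : H -> W)
    (v : R -> H) : square_integrable_vector T v ->
  square_integrable_vector T (fun t => \sum_(w <- e) ip (v t) w *: y w).
Proof.
move=> [sv nv]; apply: (@square_integrable_vector_le _ _ _ W _
  (fun t => (\sum_(w <- e) `|w| * `|y w|) * `|v t|)).
- exact: (simple_limit_comp (@expansion_continuous _ e y) sv).
- exact: square_integrableZ.
- by move=> t; exact: norm_expansion_le.
Qed.

Lemma weak_derivative_ip_primitive (v dv : R -> H) (w : H) : 0 < T ->
  square_integrable_vector T v -> square_integrable_vector T dv ->
  weak_derivative_H ip T v dv ->
  exists c, ae_in T (fun t =>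
    ip (v t) w = c + primitive ((fun t => ip (dv t) w) \_ D) t).
Proof.
move=> T0 sv sdv vdv; apply: weak_derivative_primitive (vdv w) => //;
  by apply: square_integrable_integrable; exact: square_integrable_ip.
Qed.

(** Finitely many coefficients determine [v], and each of them is almost everywhere a constant plus
    a continuous primitive. *)
Lemma weak_derivative_representative (v dv : R -> H) (e : seq H) : 0 < T ->
  square_integrable_vector T v -> square_integrable_vector T dv ->
  weak_derivative_H ip T v dv ->
  (forall t, v t = \sum_(w <- e) ip (v t) w *: w) ->
  exists v' : R -> H, continuous v' /\ ae_in T (fun t => v t = v' t).
Proof.
move=> T0 sv sdv vdv ve.
have [c hc] := choice (fun w => weak_derivative_ip_primitive w T0 sv sdv vdv).
pose a w t := c w + primitive ((fun t => ip (dv t) w) \_ D) t.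
exists (fun t => \sum_(w <- e) a w t *: w); split.
- have ca w : continuous (a w).
    move=> t; apply: cvgD; first exact: cvg_cst.
    apply/primitive_continuous/(integrable_restrictT mD).
    by apply: square_integrable_integrable; exact: square_integrable_ip.
  move=> t; elim: (e) => [|w s IH].
    by under eq_fun do rewrite big_nil; exact: cvg_cst.
  under eq_fun do rewrite big_cons; apply: cvgD => //.
  by apply: cvgZ; [exact: ca|exact: cvg_cst].
- apply: ae_inS (ae_in_seq e hc) => t _ hae; rewrite ve big_seq [RHS]big_seq.
  by apply: eq_bigr => w we; rewrite hae.
Qed.

End expansions.

(** * The spaces [Qt] and [Q + Qt] *)

Section subspaces.
Context {R : realType} {H : normedModType R} {ip : H -> H -> R}.
Hypothesis hip : inner_product ip.

(** The generators serve as separating list: a vector of [S] orthogonal to all of them is orthogonal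
    to itself. *)
Lemma finite_dim_subspaceP (S : set H) : finite_dim_subspace S ->
  [/\ S 0, forall a x y, S x -> S y -> S (a *: x + y)
    & exists s : seq H, forall x, S x ->
        (forall w, w \in s -> ip x w = 0) -> x = 0].
Proof.
move=> [n [v ->]]; split.
- by exists (fun=> 0) => //; rewrite big1// => i _; rewrite scale0r.
- move=> a _ _ [c _ <-] [d _ <-]; exists (fun i => a * c i + d i) => //.
  rewrite scaler_sumr -big_split/=; apply: eq_bigr => i _.
  by rewrite scalerDl scalerA.
- exists [seq v i | i <- enum 'I_n] => _ [c _ <-] h; apply: (ip_eq0 hip).
  rewrite (ip_sumr hip) big1// => i _.
  by rewrite (ipZr hip) h ?mulr0// map_f// mem_enum.
Qed.

Lemma bilinear_on_suml (V : set H) (b : H -> H -> R) (e : seq H) (a : H -> R)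
    (z : H -> H) y :
  V 0 -> (forall a x y, V x -> V y -> V (a *: x + y)) -> bilinear_on V b ->
  (forall w, w \in e -> V (z w)) -> V y ->
  b (\sum_(w <- e) a w *: z w) y = \sum_(w <- e) a w * b (z w) y.
Proof.
move=> V0 VD hb; elim: e => [|w e IH] Vz Vy.
  by rewrite !big_nil; have [] := hb 1 0 0 y V0 V0 Vy; rewrite scaler0 addr0; lra.
have Vz' w' : w' \in e -> V (z w') by move=> w'e; apply: Vz; rewrite inE w'e orbT.
have Vs : V (\sum_(w <- e) a w *: z w) by exact: subspace_sum.
rewrite !big_cons -(IH Vz' Vy).
by have [] := hb (a w) (z w) _ y (Vz _ (mem_head _ _)) Vs Vy.
Qed.

End subspaces.

Section sum_space.
Context {R : realType} {Q H : normedModType R} (iota : {linear Q -> H}).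
Variable Qt : set H.
Hypothesis Qt0 : Qt 0.
Hypothesis QtD : forall a x y, Qt x -> Qt y -> Qt (a *: x + y).

Lemma sum_space_l q : sum_space iota Qt (iota q).
Proof. by exists q, 0; rewrite addr0. Qed.

Lemma sum_space_r w : Qt w -> sum_space iota Qt w.
Proof. by move=> Qw; exists 0, w; rewrite linear0 add0r. Qed.

Lemma sum_space0 : sum_space iota Qt 0.
Proof. exact: sum_space_r. Qed.

Lemma sum_spaceD a x y : sum_space iota Qt x -> sum_space iota Qt y ->
  sum_space iota Qt (a *: x + y).
Proof.
move=> [q [w [Qw ->]]] [q' [w' [Qw' ->]]].
exists (a *: q + q'), (a *: w + w'); split; first exact: QtD.
by rewrite linearP scalerDr addrACA.
Qed.

Variable b : H -> H -> R.
Hypothesis hb : bilinear_on (sum_space iota Qt) b.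

Lemma form_linearl a q q' z :
  b (iota (a *: q + q')) (iota z) = a * b (iota q) (iota z) + b (iota q') (iota z).
Proof.
rewrite linearP.
by have [] := hb a (sum_space_l q) (sum_space_l q') (sum_space_l z).
Qed.

Lemma form_linearr a q q' z :
  b (iota z) (iota (a *: q + q')) = a * b (iota z) (iota q) + b (iota z) (iota q').
Proof.
rewrite linearP.
by have [] := hb a (sum_space_l q) (sum_space_l q') (sum_space_l z).
Qed.

Lemma form_subl q q' z :
  b (iota (q - q')) (iota z) = b (iota q) (iota z) - b (iota q') (iota z).
Proof. by rewrite addrC -scaleN1r form_linearl mulN1r addrC. Qed.

Lemma form_subr q q' z :
  b (iota z) (iota (q - q')) = b (iota z) (iota q) - b (iota z) (iota q').
Proof. by rewrite addrC -scaleN1r form_linearr mulN1r addrC. Qed.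

End sum_space.

(** * Linearity of the Riesz map and of the reconstruction *)

Section elliptic_reconstruction.
Context {R : realType} {Q H : normedModType R} {ip : H -> H -> R}.
Hypothesis hip : inner_product ip.
Variable iota : {linear Q -> H}.
Variable Qt : set H.
Hypothesis Qt0 : Qt 0.
Hypothesis QtD : forall a x y, Qt x -> Qt y -> Qt (a *: x + y).
Variable b : H -> H -> R.
Hypothesis hb : bilinear_on (sum_space iota Qt) b.
Hypothesis b_coercive : coercive_form (fun q q' : Q => b (iota q) (iota q')).
Variable B : H -> H.
Hypothesis hB : forall w, Qt w -> riesz_representative ip Qt (b w) (B w).
Variables (F : H) (E : H -> Q).
Hypothesis hE : forall w, Qt w -> forall q' : Q,
  b (iota (E w)) (iota q') = ip (B w + F) (iota q').
Variable e : seq H.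
Hypothesis eQt : forall w, w \in e -> Qt w.
Hypothesis e_expansion : forall x, Qt x -> x = \sum_(w <- e) ip x w *: w.

(** [B] is given by its defining property on [Qt] alone; uniqueness of Riesz representatives makes
    it linear there. *)
Lemma riesz_expansion x : Qt x -> B x = \sum_(w <- e) ip x w *: B w.
Proof.
move=> Qx; have QB w : w \in e -> Qt (B w) by move=> /eQt /hB[].
have Qs : Qt (\sum_(w <- e) ip x w *: B w) by exact: subspace_sum.
apply/eqP; rewrite -subr_eq0; apply/eqP/(ip_eq0 hip).
set z := B x - _; have Qz : Qt z.
  by rewrite /z addrC -scaleN1r; apply: QtD => //; case: (hB Qx).
rewrite {1}/z (ipBl hip) (ip_suml hip).
have [_ ->//] := hB Qx; apply/eqP; rewrite subr_eq0; apply/eqP.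
rewrite {1}(e_expansion Qx) (bilinear_on_suml _ (V := sum_space iota Qt)).
- rewrite big_seq [RHS]big_seq; apply: eq_bigr => w we; rewrite (ipZl hip).
  by have [_ ->] := hB (eQt we).
- exact: sum_space0.
- exact: sum_spaceD.
- exact: hb.
- by move=> w /eQt; exact: sum_space_r.
- exact: sum_space_r.
Qed.

(** On [Qt] the map [E] is affine, the offset [E 0] coming from the datum [F]. Both sides solve the
    same variational equation, and coercivity leaves only one solution. *)
Lemma elliptic_reconstruction_expansion x : Qt x ->
  E x = E 0 + \sum_(w <- e) ip x w *: (E w - E 0).
Proof.
move=> Qx; set z := (X in _ = X).
have bz q : b (iota (E x - z)) (iota q) = 0.
  have zE : z = \sum_(w <- e) ip x w *: (E w - E 0) + 1 *: E 0.
    by rewrite scale1r addrC.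
  rewrite (form_subl Qt0 hb) hE// zE.
  (* The induction runs over arbitrary lists in [Qt], since the tail of [e] no longer expands
     [x]. *)
  have key : forall s : seq H, (forall w, w \in s -> Qt w) ->
      b (iota (\sum_(w <- s) ip x w *: (E w - E 0) + 1 *: E 0)) (iota q) =
      ip (\sum_(w <- s) ip x w *: B w + F) (iota q).
    elim=> [|w s IH] sQt.
      rewrite !big_nil add0r scale1r hE// (riesz_expansion Qt0).
      by rewrite big1// => w _; rewrite (ip0l hip) scale0r.
    have sQt' w' : w' \in s -> Qt w' by move=> w's; apply: sQt; rewrite inE w's orbT.
    have Qw : Qt w by exact: sQt (mem_head _ _).
    rewrite !big_cons -!addrA (form_linearl Qt0 hb) (ipDl hip) (ipZl hip) IH//.
    congr (_ + _); rewrite (form_subl Qt0 hb) !hE//.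
    by rewrite -(ipBl hip) opprD addrACA subrr addr0 (riesz_expansion Qt0)
      big1 ?subr0// => w' _; rewrite (ip0l hip) scale0r.
  by rewrite key// -riesz_expansion// subrr.
have [a a0 /(_ (E x - z))] := b_coercive; rewrite bz => az.
apply/eqP; rewrite -subr_eq0 -normr_le0 -(@pmulr_rle0 _ a)//.
have : `|E x - z| ^+ 2 <= 0 by rewrite -(@pmulr_rle0 _ a).
by rewrite real_exprn_even_le0//= => /eqP ->; rewrite mulr0.
Qed.

End elliptic_reconstruction.

(** * The error bound in the energy norm *)

Theorem corollary2p6 (R : realType)
  (* the Hilbert spaces Q and H *)
  (Q H : completeNormedModType R)
  (ipQ : Q -> Q -> R) (hipQ : inner_product ipQ)
  (ip : H -> H -> R) (hip : inner_product ip)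
  (* the dense continuous embedding of Q into H *)
  (iota : {linear Q -> H}) (iota_inj : injective iota)
  (iota_cont : continuous iota) (iota_dense : dense (range iota))
  (* the finite dimensional space Qt *)
  (Qt : set H) (hQt : finite_dim_subspace Qt)
  (* data of the parabolic problem *)
  (T : R) (hT : 0 < T) (f : H) (p0 : Q)
  (b : H -> H -> R) (hb : bilinear_on (sum_space iota Qt) b)
  (b_bounded : bounded_form (fun q q' : Q => b (iota q) (iota q')))
  (b_coercive : coercive_form (fun q q' : Q => b (iota q) (iota q')))
  (N : H -> R) (hN : norm_on (sum_space iota Qt) N)
  (N_energy : forall q : Q, N (iota q) ^+ 2 = b (iota q) (iota q))
  (CHQ : R) (hCHQ : forall q : Q, `|iota q| <= CHQ * N (iota q))
  (* elliptic reconstruction *)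
  (Pi : H -> H) (hPi : orthogonal_projection ip Qt Pi)
  (B : H -> H)
  (hB : forall w, Qt w -> riesz_representative ip Qt (b w) (B w))
  (E : H -> Q)
  (hE : forall w, Qt w -> forall q' : Q,
     b (iota (E w)) (iota q') = ip (B w - Pi f + f) (iota q'))
  (* the solution of the parabolic problem *)
  (p : R -> Q) (hp : L2 [set: Q] (fun q => `|q|) T p)
  (dp : R -> Q -> R) (hdp : L2 (@top_dual R Q) (@top_dual_norm R Q) T dp)
  (p_dp : weak_derivative_Gelfand ip iota T p dp)
  (p_eq : ae_in T (fun t => forall q : Q,
     dp t q + b (iota (p t)) (iota q) = ip f (iota q)))
  (p_init : initial_value T (fun t => iota (p t)) (iota p0))
  (* the discrete approximation *)
  (pt : R -> H) (hpt : L2 Qt (fun x => `|x|) T pt)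
  (dpt : R -> H) (hdpt : L2 Qt (fun x => `|x|) T dpt)
  (pt_dpt : weak_derivative_H ip T pt dpt)
  (* its time-stepping residual *)
  (RT : R -> H)
  (hRT : ae_in T (fun t => riesz_representative ip Qt
     (fun w => ip (dpt t) w + b (pt t) w - ip f w) (RT t)))
  (* the decomposition pt = ptc + ptd *)
  (ptc : R -> Q)
  (ptd : R -> H) (hptd : L2 Qt (fun x => `|x|) T ptd)
  (dptd : R -> H) (hdptd : L2 Qt (fun x => `|x|) T dptd)
  (ptd_dptd : weak_derivative_H ip T ptd dptd)
  (pt_split : ae_in T (fun t => pt t = iota (ptc t) + ptd t)) :
  let e := fun t => iota (p t) - pt t in
  let ec := fun t => iota (p t) - iota (ptc t) in
  let eps := fun t => iota (E (pt t)) - pt t in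
  let bnorm := continuity_constant (fun q : Q => N (iota q))
                 (fun q q' : Q => b (iota q) (iota q')) in
  let C := Num.sqrt (3 * bnorm ^+ 2 + 2) in
  (L2norm T N e <=
     `|at0 T ec|%:E
     + 2%:E * L2norm T (dual_norm ip iota N) dptd
     + (C + 1)%:E * L2norm T N eps
     + C%:E * L2norm T N ptd
     + (2 * CHQ)%:E * L2norm T (fun x => `|x|%R) RT)%E.
Proof.
cbv zeta.
set e := fun t => iota (p t) - pt t; set ec := fun t => _ - iota (ptc t).
set eps := fun t => iota (E (pt t)) - pt t; set bnorm := continuity_constant _ _.
set C := Num.sqrt _.
pose D : set (measurableTypeR R) := `]0, T[%classic.
have mD : measurable D by exact: measurable_itv.
have [Qt0 QtD [s s_total]] := finite_dim_subspaceP hip hQt.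
pose V := sum_space iota Qt.
have V0 : V 0 := sum_space0 iota Qt0.
have VD : forall a x y, V x -> V y -> V (a *: x + y) := sum_spaceD QtD.
have VQ q : V (iota q) := sum_space_l iota Qt0 q.
have VQt w : Qt w -> V w := @sum_space_r _ _ _ iota Qt w.
have QtB x y : Qt x -> Qt y -> Qt (x - y).
  by move=> Qx Qy; rewrite addrC -scaleN1r; exact: QtD.
have VB x y : V x -> V y -> V (x - y).
  by move=> Qx Qy; rewrite addrC -scaleN1r; exact: VD.
have [N_ge0 _ _ ND] := hN.
have [B1 [B1Qt B1e]] := finite_expansion hip Qt0 QtD s_total.
(* The intersection of [Qt] with the image of [Q], where [pt - ptd] takes its values almost
   everywhere. *)
pose S : set H := [set x | Qt x /\ exists q, iota q = x].
have [||x [Qx _]|B2 [B2S B2e]] := @finite_expansion _ _ _ hip S s.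
- by split => //; exists 0; rewrite linear0.
- move=> a x y [Qx [q qx]] [Qy [q' qy]]; split; first exact: QtD.
  by exists (a *: q + q'); rewrite linearP qx qy.
- exact: s_total.
have [sect sectP] : exists sect : H -> Q, forall x, S x -> iota (sect x) = x.
  exists (fun x => get [set q | iota q = x]) => x [_ hx].
  exact: (@getPex _ [set q | iota q = x] hx).
(* [ptc] need not be measurable in [Q]: off a null set it may be replaced by
   [kap (pt - ptd)], which is linear in the coefficients of [pt - ptd]. *)
pose kap x := \sum_(w <- B2) ip x w *: sect w.
have kapP x : S x -> iota (kap x) = x.
  move=> Sx; rewrite {2}(B2e x Sx) /kap linear_sum big_seq [RHS]big_seq.
  by apply: eq_bigr => w wB2; rewrite linearZ/= sectP//; exact: B2S.
pose bq (q q' : Q) := b (iota q) (iota q').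
pose Nq (q : Q) := N (iota q).
have Nq_ge0 q : 0 <= Nq q by exact: (N_ge0 _ (VQ q)).
have bn0 : 0 <= bnorm.
  exact: (continuity_constant_ge0 b_bounded b_coercive Nq_ge0 N_energy).
have bnP q q' : `|bq q q'| <= bnorm * Nq q * Nq q'.
  exact: (continuity_constantP b_bounded b_coercive Nq_ge0 N_energy).
have [M _ bM] := bounded_formP b_bounded.
have [MN _ NM] := energy_norm_le b_bounded Nq_ge0 N_energy.
have Nq_gt0 q : q != 0 -> 0 < Nq q.
  move=> q0; rewrite lt_neqAle Nq_ge0 andbT eq_sym.
  by apply: contra q0 => /eqP h; apply/eqP; exact: (energy_norm_eq0 b_coercive Nq_ge0 N_energy h).
(* The sign of [CHQ] is open when [Q = {0}]; [CQr] below returns to [CHQ]. *)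
pose CQ := `|CHQ|.
have iota_le q : `|iota q| <= CQ * Nq q.
  by rewrite (le_trans (hCHQ q))// ler_wpM2r ?ler_norm//; exact: Nq_ge0.
have iota_leM q : `|iota q| <= CQ * MN * `|q|.
  rewrite (le_trans (iota_le q))// -mulrA.
  by apply: ler_wpM2l; [exact: normr_ge0|exact: NM].
have toQt v : L2 Qt (fun x => `|x|) T v -> exists v', [/\ square_integrable_vector T v',
    forall t, Qt (v' t) & ae_in T (fun t => v t = v' t)].
  by move=> /(L2_simple_limit Qt0)[v' [? ? ? ?]]; exists v'.
have [p' [sp' _ pp' np']] := L2_simple_limit (I : [set: Q] 0) hp.
have {np'} sp' : square_integrable_vector T p' by [].
have [pt' [spt' Qpt' ptE]] := toQt _ hpt.
have [dpt' [sdpt' Qdpt' dptE]] := toQt _ hdpt.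
have [ptd' [sptd' Qptd' ptdE]] := toQt _ hptd.
have [dptd' [sdptd' Qdptd' dptdE]] := toQt _ hdptd.
pose u t := p' t - kap (pt' t - ptd' t).
have su : square_integrable_vector T u.
  apply: square_integrable_vectorB => //; apply: square_integrable_expansion => //.
  exact: square_integrable_vectorB.
(* An explicit form of the residual: [B] represents [b (pt t)] on [Qt] and [Pi f] represents [f]. *)
pose RT' t := dpt' t + \sum_(w <- B1) ip (pt' t) w *: B w - Pi f.
have sRT' : square_integrable_vector T RT'.
  apply: square_integrable_vectorB; last exact: square_integrable_vector_cst.
  by apply: square_integrable_vectorD => //; exact: square_integrable_expansion.
have Bexp := riesz_expansion hip Qt0 QtD hb hB B1Qt B1e.
have RT'E t : RT' t = dpt' t + B (pt' t) - Pi f by rewrite /RT' -Bexp.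
have ptcE : ae_in T (fun t => iota (kap (pt' t - ptd' t)) = pt' t - ptd' t /\
    iota (ptc t) = pt' t - ptd' t).
  apply: ae_inS (ae_inI pt_split (ae_inI ptE ptdE)) => t _ [ptc_t [ptE_t ptdE_t]].
  have e1 : iota (ptc t) = pt' t - ptd' t by rewrite -ptE_t -ptdE_t ptc_t addrK.
  split => //; apply: kapP; split; first exact: QtB.
  by exists (ptc t).
have ecE : ae_in T (fun t => ec t = iota (u t)).
  apply: ae_inS (ae_inI pp' ptcE) => t _ [p_t [k_t ptc_t]].
  by rewrite /ec /u linearB/= k_t ptc_t p_t.
have RTE : ae_in T (fun t => RT t = RT' t).
  apply: ae_inS (ae_inI hRT (ae_inI ptE dptE)) => t _ [[QRT RTt] [pt_t dpt_t]].
  apply/eqP; rewrite -subr_eq0; apply/eqP/(ip_eq0 hip).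
  have [QB BP] := hB _ (Qpt' t); have [QPi PiP] := hPi f.
  have QRT' : Qt (RT' t).
    by rewrite RT'E; apply: QtB => //; rewrite -[dpt' t]scale1r; exact: QtD.
  have : Qt (RT t - RT' t) by exact: QtB.
  move: {1 3}(RT t - RT' t) => d Qd.
  rewrite (ipBl hip) RTt// RT'E (ipBl hip) (ipDl hip) BP// pt_t dpt_t.
  by have := PiP _ Qd; rewrite (ipBl hip); lra.
have hE' w : Qt w -> forall q', b (iota (E w)) (iota q') = ip (B w + (- Pi f + f)) (iota q').
  by move=> Qw q'; rewrite hE// addrA.
have Eexp := elliptic_reconstruction_expansion hip Qt0 QtD hb b_coercive hB hE' B1Qt B1e.
(* The reconstruction error becomes an affine function of finitely many coefficients of [pt'], hence
   of Lipschitz norm. *)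
have epsE t : iota (E (pt' t)) - pt' t = iota (E 0) +
    \sum_(w <- B1) ip (pt' t) w *: (iota (E w - E 0) - w).
  rewrite (Eexp _ (Qpt' t)) linearD -addrA; congr (_ + _).
  rewrite linear_sum [X in _ - X](B1e _ (Qpt' t)) -sumrB; apply: eq_bigr => w _.
  by rewrite linearZ scalerBr.
pose y t := Nq (u t).
have sy : square_integrable T y.
  apply: (square_integrable_lipschitz (F := Nq) (K := MN) _ su) => q q'.
  rewrite (le_trans (norm_on_dist VD hN (VQ q) (VQ q')))//.
  by rewrite -linearB; exact: NM.
pose alpha t := N (iota (E (pt' t)) - pt' t).
have Vz w : w \in B1 -> V (iota (E w - E 0) - w).
  by move=> wB1; apply: VB; [exact: VQ|apply: VQt; exact: B1Qt].
have salpha : square_integrable T alpha.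
  rewrite /alpha; under eq_fun do rewrite epsE.
  have [K hK] := norm_on_expansion_lipschitz hip V0 VD hN (VQ (E 0)) Vz.
  exact: (square_integrable_lipschitz hK spt').
pose beta t := N (ptd' t).
have sbeta : square_integrable T beta.
  rewrite /beta; under eq_fun do rewrite (B1e _ (Qptd' _)) -[\sum_(_ <- _) _]add0r.
  have [K hK] := norm_on_expansion_lipschitz hip V0 VD hN V0
    (fun w wB1 => VQt w (B1Qt w wB1)).
  exact: (square_integrable_lipschitz hK sptd').
pose dl t := dual_norm ip iota N (dptd' t).
have sdl : square_integrable T dl.
  apply: (square_integrable_lipschitz _ sdptd').
  exact: (dual_norm_lipschitz hip Nq_gt0 iota_le).
pose rho t := `|RT' t|.
have srho : square_integrable T rho by case: sRT'.
pose kappa t := bnorm * (alpha t + beta t) + dl t + CQ * rho t.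
have skappa : square_integrable T kappa.
  apply: square_integrableD; last exact: square_integrableZ.
  apply: square_integrableD => //; apply: square_integrableZ.
  exact: square_integrableD.
(* The derivative of [e^c = p - pt + ptd] paired with [z], the derivative of [p] being expressed by
   the parabolic equation. *)
pose g t z := ip f (iota z) - bq (p' t) z - ip (dpt' t) (iota z) + ip (dptd' t) (iota z).
have gB t z z' : g t (z - z') = g t z - g t z'.
  by rewrite /g /bq (form_subr Qt0 hb) linearB !(ipBr hip); ring.
(* This bound refers to the Hilbert norm of [Q], not to the energy norm: only its square
   integrability matters, since it cancels in [energy_estimate]. *)
pose gam t := M * `|p' t| + CQ * MN * (`|f| + `|dpt' t| + `|dptd' t|).
have sgam : square_integrable T gam.
  apply: square_integrableD; first by apply: square_integrableZ; case: sp'.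
  apply: square_integrableZ; apply: square_integrableD; last by case: sdptd'.
  by apply: square_integrableD; [exact: square_integrable_cst|case: sdpt'].
have g_le t z : `|g t z| <= gam t * `|z|.
  have ip_le x : `|ip x (iota z)| <= CQ * MN * `|x| * `|z|.
    rewrite (le_trans (ip_norm hip _ _))//.
    by rewrite [leRHS]mulrAC [leLHS]mulrC ler_wpM2r ?iota_leM.
  rewrite /g (le_trans (ler_normD _ _))// (le_trans (lerD (ler_normB _ _) (lexx _)))//.
  rewrite (le_trans (lerD (lerD (ler_normB _ _) (lexx _)) (lexx _)))//.
  rewrite (le_trans (lerD (lerD (lerD (ip_le _) (bM _ _)) (ip_le _)) (ip_le _)))//.
  by rewrite le_eqVlt /gam; apply/orP; left; apply/eqP; ring.
have sip v z : square_integrable_vector T v ->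
    square_integrable T (fun t => ip (v t) (iota z)) by exact: square_integrable_ip.
have sN f1 : square_integrable T f1 -> square_integrable T (fun t => - f1 t).
  move=> /(square_integrableZ (-1)); congr square_integrable.
  by apply/funext => t; rewrite mulN1r.
have sgp z : square_integrable T (fun t => ip f (iota z) - bq (p' t) z).
  apply: square_integrableD; first exact: square_integrable_cst.
  apply: sN; apply: (square_integrable_lipschitz (F := bq^~ z) (K := M * `|z|) _ sp').
  move=> q q'; rewrite /bq -(form_subl Qt0 hb) (le_trans (bM _ _))//.
  by rewrite mulrAC.
have sg z : square_integrable T (g^~ z).
  apply: square_integrableD; last exact: sip.
  by apply: square_integrableD; [exact: sgp|apply: sN; exact: sip].
have wpt' : weak_derivative_H ip T pt' dpt'.
  by move=> w; apply: weak_derivative_ae (pt_dpt w);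
    [apply: ae_inS ptE|apply: ae_inS dptE] => t _ ->.
have wptd' : weak_derivative_H ip T ptd' dptd'.
  by move=> w; apply: weak_derivative_ae (ptd_dptd w);
    [apply: ae_inS ptdE|apply: ae_inS dptdE] => t _ ->.
(* [at0] is a choice, so a continuous representative must be exhibited: the given one of [p]
   combined with those of [pt] and [ptd]. *)
have [w [cw wE w0]] : initial_value T ec (at0 T ec).
  apply: getPex.
  have [wp [cwp wpE _]] := p_init.
  have [w2 [cw2 w2E]] := weak_derivative_representative hip hT spt' sdpt' wpt'
    (fun t => B1e _ (Qpt' t)).
  have [w3 [cw3 w3E]] := weak_derivative_representative hip hT sptd' sdptd' wptd'
    (fun t => B1e _ (Qptd' t)).
  exists (wp 0 - w2 0 + w3 0), (fun t => wp t - w2 t + w3 t); split => //.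
    apply: within_continuousD; last exact: continuous_subspaceT.
    by apply: within_continuousB => //; exact: continuous_subspaceT.
  apply: ae_inS (ae_inI ptcE (ae_inI wpE (ae_inI w2E w3E))) => t _.
  move=> [[_ ptc_t] [<- [<- <-]]].
  by rewrite /ec ptc_t opprB addrA addrAC.
pose U t := w (clip T t).
have cU : continuous U by exact: within_continuous_clip.
have U0 t : t <= 0 -> U t = U 0 by move=> t0; rewrite /U !clip_le0.
have UE : ae_in T (fun t => U t = iota (u t)).
  apply: ae_inS (ae_inI wE ecE) => t /andP[t0 tT] [w_t ec_t].
  by rewrite /U clip_id ?(ltW t0) ?(ltW tT)// -w_t.
have gU z t r : ip (U t - U r) (iota z) =
    primitive ((g^~ z) \_ D) t - primitive ((g^~ z) \_ D) r.
  have int1 f1 : square_integrable T f1 ->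
      lebesgue_measure.-integrable setT (EFin \o f1 \_ D).
    by move=> s1; apply: integrable_restrictT => //; exact: square_integrable_integrable.
  pose d1 t := ip f (iota z) - bq (p' t) z.
  pose d2 t := ip (dpt' t) (iota z); pose d3 t := ip (dptd' t) (iota z).
  have sd1 : square_integrable T d1 by exact: sgp.
  have sd2 : square_integrable T d2 by exact: sip.
  have sd3 : square_integrable T d3 by exact: sip.
  have [c1 hc1] : exists c, ae_in T (fun t => ip (iota (p' t)) (iota z) =
      c + primitive (d1 \_ D) t).
    apply: weak_derivative_primitive => //.
    - apply: square_integrable_integrable.
      apply: (square_integrable_lipschitz (F := fun q => ip (iota q) (iota z))
        (K := CQ * MN * `|iota z|) _ sp') => q q'.
      rewrite -(ipBl hip) -linearB (le_trans (ip_norm hip _ _))// [leRHS]mulrAC.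
      by rewrite ler_wpM2r ?iota_leM.
    - exact: square_integrable_integrable.
    (* The parabolic equation identifies [dp t z] with [d1 t] almost everywhere. *)
    - apply: weak_derivative_ae (p_dp z); first by apply: ae_inS pp' => x _ ->.
      apply: ae_inS (ae_inI p_eq pp') => x _ [p_x pp_x].
      by rewrite /d1 /bq -pp_x; have := p_x z; lra.
  have [c2 hc2] : exists c, ae_in T (fun t => ip (pt' t) (iota z) =
      c + primitive (d2 \_ D) t) by exact: weak_derivative_ip_primitive.
  have [c3 hc3] : exists c, ae_in T (fun t => ip (ptd' t) (iota z) =
      c + primitive (d3 \_ D) t) by exact: weak_derivative_ip_primitive.
  have gE : (g^~ z) \_ D = fun x => (d1 \_ D) x - (d2 \_ D) x + (d3 \_ D) x.
    apply/funext => x; rewrite /patch; case: ifPn => // _.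
    by rewrite subr0 addr0.
  have i12 : lebesgue_measure.-integrable setT
      (EFin \o (fun x => (d1 \_ D) x - (d2 \_ D) x)).
    by have := integrableB measurableT (int1 _ sd1) (int1 _ sd2); apply: eq_integrable.
  have PE x : primitive ((g^~ z) \_ D) x =
      primitive (d1 \_ D) x - primitive (d2 \_ D) x + primitive (d3 \_ D) x.
    by rewrite gE primitiveD// ?primitive_sub//; exact: int1.
  (* [h] is continuous and almost everywhere constant on [(0, T)], hence constant on [[0, T]];
     beyond, both [U] and the primitive stay at their end values. *)
  pose h x := ip (U x) (iota z) - primitive ((g^~ z) \_ D) x.
  have ch : continuous h.
    move=> x; apply: cvgB.
      by apply: (ip_cvg hip); [exact: cU|exact: cvg_cst].
    by apply: primitive_continuous; exact: int1.
  have hh x : h x = c1 - c2 + c3.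
    have h01 : forall x, 0 <= x <= T -> h x = c1 - c2 + c3.
      apply: continuous_ae_cst => //.
      apply: ae_inS (ae_inI (ae_inI UE ptcE) (ae_inI hc1 (ae_inI hc2 hc3))).
      move=> x' _ [[U_x [k_x _]] [h1 [h2 h3]]].
      rewrite /h U_x /u linearB k_x (ipBl hip) (ipBl hip) h1 h2 h3 PE.
      by ring.
    have hclip : h x = h (clip T x).
      have cc : clip T (clip T x) = clip T x by rewrite clip_id ?clip_in.
      rewrite /h /U cc; congr (_ - _).
      have [x0|x0] := leP x 0.
        rewrite clip_le0//; apply/esym/primitive_cst => //; first exact: int1.
        move=> x' /andP[_ x'0]; rewrite /patch memNset// /D /= in_itv/=.
        by move=> /andP[]; rewrite ltNge x'0.
      have [xT|xT] := leP T x; last by rewrite clip_id// (ltW x0) (ltW xT).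
      rewrite clip_ge//; apply: primitive_cst => //; first exact: int1.
      move=> x' /andP[x'T _]; rewrite /patch memNset// /D /= in_itv/=.
      by move=> /andP[_]; rewrite ltNge (ltW x'T).
    by rewrite hclip h01// clip_in.
  have := hh t; have := hh r; rewrite /h (ipBl hip); lra.
have [[us [us_simple us_cvg]] nu] := su.
have us_fin n : finite_set (range (us n)) by have [] := us_simple n.
have us_ae : ae_in T (fun t => us n t @[n --> \oo] --> u t).
  by apply: ae_inW; exact: aeW.
have [L [mL L0 LE intL]] := energy_inequality hip hT us_fin us_ae cU U0 UE gB
  (fun t z _ => g_le t z) (fun z => square_integrable_integrable (sg z))
  (square_integrable_integrable sgam) sgam.2 nu.2 gU.
have hgu : ae_in T (fun t => g t (u t) <= - y t ^+ 2 + kappa t * y t).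
  apply: ae_inS ptcE => t _ [k_t _].
  (* Since [iota k = pt' - ptd'], the vector [iota z] is the reconstruction error plus [ptd']. The
     equation for [E] tested with [u t] turns [f - dpt'] into [bq (E pt')] minus the residual, and
     [bq (p')] splits as [bq (u t)] plus [bq k]. *)
  pose k := kap (pt' t - ptd' t); pose z := E (pt' t) - k.
  have Nz : Nq z <= alpha t + beta t.
    rewrite /Nq /z linearB k_t opprB addrCA [ptd' t + _]addrC.
    by apply: ND; [apply: VB; [exact: VQ|exact: VQt]|exact: VQt].
  have -> : g t (u t) = bq z (u t) - y t ^+ 2 - ip (RT' t) (iota (u t)) +
      ip (dptd' t) (iota (u t)).
    rewrite /y /Nq N_energy -/(bq (u t) (u t)).
    have -> : bq (u t) (u t) = bq (p' t) (u t) - bq k (u t).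
      exact: (form_subl Qt0 hb).
    have -> : bq z (u t) = bq (E (pt' t)) (u t) - bq k (u t).
      exact: (form_subl Qt0 hb).
    rewrite /bq hE// RT'E /g /bq !(ipDl hip) !(ipNl hip); lra.
  have h1 : bq z (u t) <= bnorm * (alpha t + beta t) * y t.
    rewrite (le_trans (ler_norm _))// (le_trans (bnP _ _))//.
    by apply: ler_wpM2r; [exact: Nq_ge0|exact: ler_wpM2l].
  have h2 : - ip (RT' t) (iota (u t)) <= CQ * rho t * y t.
    rewrite (le_trans (ler_norm _))// normrN (le_trans (ip_norm hip _ _))//.
    rewrite [CQ * _]mulrC -mulrA.
    by apply: ler_wpM2l; [exact: normr_ge0|exact: iota_le].
  have h3 : ip (dptd' t) (iota (u t)) <= dl t * y t.
    have [u0|u0] := eqVneq (u t) 0.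
      by rewrite /y /Nq u0 linear0 (ip0r hip) (norm_on0 V0 hN) mulr0.
    exact: (dual_normP hip Nq_gt0 iota_le).
  by rewrite /kappa !mulrDl; lra.
pose W := `|at0 T ec|.
have UW : `|U 0| = W by rewrite /U clip_le0// w0.
rewrite UW in intL.
have main := energy_estimate sgam nu sy skappa (normr_ge0 _) mL L0 LE intL hgu.
have e_le : (L2norm T N e <= L2norm T id (fun t => y t + beta t)%R)%E.
  apply: L2norm_ae_le; apply: ae_inS (ae_inI ptcE (ae_inI pp' ptE)) => t _.
  move=> [[k_t _] [p_t pt_t]].
  have -> : e t = iota (u t) - ptd' t.
    by rewrite /e /u linearB k_t p_t pt_t opprB addrA addrAC addrK.
  have Vu := VQ (u t); have Vd := VQt _ (Qptd' t).
  apply/andP; split; last exact: (norm_on_sub V0 VD hN).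
  by apply: N_ge0; exact: VB.
have real_norm f1 : square_integrable T f1 ->
    exists2 r, 0 <= r & L2norm T id f1 = r%:E.
  move=> sf; exists (Num.sqrt (\int[lebesgue_measure]_(t in D) (f1 t ^+ 2))).
    exact: sqrtr_ge0.
  exact: L2norm_square_integrable.
have [a a0 aE] := real_norm _ salpha; have [c c0 cE] := real_norm _ sbeta.
have [d d0 dE] := real_norm _ sdl; have [r r0 rE] := real_norm _ srho.
have epsa : L2norm T N eps = a%:E.
  by rewrite -aE; apply: L2norm_ae_eq; apply: ae_inS ptE => t _ pt_t;
    rewrite /eps /alpha pt_t.
have ptdc : L2norm T N ptd = c%:E.
  by rewrite -cE; apply: L2norm_ae_eq; apply: ae_inS ptdE => t _ ->.
have dptdd : L2norm T (dual_norm ip iota N) dptd = d%:E.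
  by rewrite -dE; apply: L2norm_ae_eq; apply: ae_inS dptdE => t _ ->.
have RTr : L2norm T (fun x => `|x|) RT = r%:E.
  by rewrite -rE; apply: L2norm_ae_eq; apply: ae_inS RTE => t _ ->.
(* A negative [CHQ] forces [Q = {0}], then [H = {0}] by density, and the residual vanishes. *)
have CQr : CHQ * r = CQ * r.
  have [CHQ0|CHQ0] := leP 0 CHQ; first by rewrite /CQ ger0_norm.
  have Q0 (q : Q) : q = 0.
    apply/eqP; apply: contraT => q0; have := le_trans (normr_ge0 _) (hCHQ q).
    by rewrite nmulr_rge0// leNgt Nq_gt0.
  have H0 x : x = 0 :> H.
    apply/eqP; apply: contraT => x0.
    have [||z [xz [q _ qz]]] := iota_dense (ball x `|x|).
    - by exists x; apply: ballxx; rewrite normr_gt0.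
    - exact: ball_open.
    by move: xz; rewrite -qz (Q0 q) linear0 -ball_normE /ball_/= subr0 ltxx.
  suff -> : r = 0 by rewrite !mulr0.
  have : L2norm T id rho = 0%E.
    rewrite /L2norm integral0_eq ?sqrte0// => t _.
    by rewrite /rho (H0 (RT' t)) normr0 expr0n.
  by rewrite rE => -[].
have kappa_le : (L2norm T id kappa <= (bnorm * (a + c) + d + CQ * r)%:E)%E.
  have [mal _] := salpha; have [mbe _] := sbeta; have [mdl _] := sdl.
  have [mrho _] := srho.
  have mab : measurable_fun D (fun t => alpha t + beta t) by exact: measurable_funD.
  have mbab : measurable_fun D (fun t => bnorm * (alpha t + beta t)).
    exact: measurable_funM.
  have mCr : measurable_fun D (fun t => CQ * rho t) by exact: measurable_funM.
  apply: le_trans (L2norm_add _ mCr) _; first exact: measurable_funD.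
  rewrite !EFinD L2norm_scale ?normr_ge0// rE; apply: leeD => //.
  apply: le_trans (L2norm_add mbab mdl) _; rewrite dE; apply: leeD => //.
  rewrite L2norm_scale// EFinM lee_wpmul2l ?lee_fin//.
  by rewrite EFinD -aE -cE; exact: L2norm_add.
rewrite epsa ptdc dptdd RTr; apply: (le_trans e_le).
have [my _] := sy; have [mbe _] := sbeta.
apply: le_trans (L2norm_add my mbe) _; rewrite cE.
(* The last summand [c] comes from splitting [ptd] off the error, so [ptd] carries the factor
   [bnorm + 1] and [eps] only [bnorm]. *)
apply: (@le_trans _ _ ((W + (bnorm * (a + c) + d + CQ * r) + c)%:E)).
  by rewrite EFinD leeD// (le_trans main)// EFinD leeD.
rewrite -!EFinM -!EFinD lee_fin -mulrA CQr.
(* [3 b^2 + 2 - (b + 1)^2 = b^2 + (b - 1)^2] is nonnegative. *)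
have Cb : bnorm + 1 <= C.
  rewrite -[leLHS]ger0_norm ?addr_ge0// -sqrtr_sqr ler_sqrt.
    by have := sqr_ge0 bnorm; nra.
  by have := sqr_ge0 bnorm; lra.
have h1 : 0 <= (C - (bnorm + 1)) * a by rewrite mulr_ge0// subr_ge0.
have h2 : 0 <= (C - (bnorm + 1)) * c by rewrite mulr_ge0// subr_ge0.
have h3 : 0 <= CQ * r by exact: mulr_ge0 (normr_ge0 _) r0.
rewrite -/W; clearbody W CQ; lra.
Qed.
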